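(* Let $0<\alpha<1$, $T>0$, $J=[0,T]$ and $f\in C(J\times\mathbb{R},\mathbb{R})$. Let $v,w:J\to\mathbb{R}$ be any differentiable functions such that ${}^{ABC}{}_0\mathcal{D}_\tau^\alpha v,\ {}^{ABC}{}_0\mathcal{D}_\tau^\alpha w\in C(J)$, satisfying the (non-strict) inequalities (i) ${}^{ABC}{}_0\mathcal{D}_\tau^\alpha v(\tau)\le f(\tau,v(\tau))$ for $\tau\in J$, (ii) ${}^{ABC}{}_0\mathcal{D}_\tau^\alpha w(\tau)\ge f(\tau,w(\tau))$ for $\tau\in J$. Suppose that there is a constant $L$ with $0<L<\frac{B(\alpha)}{1-\alpha}$ such that $$f(\tau,\omega)-f(\tau,\eta)\le L(\omega-\eta)\quad\text{for all }\tau\in J\text{ and all }\omega,\eta\in\mathbb{R}\text{ with }\omega\ge\eta.$$ Then $v(0)\le w(0)$ implies $v(\tau)\le w(\tau)$ for all $\tau\in J$.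
   Context: Let $0<\alpha<1$ and let $B$ be a fixed normalization function on $[0,1]$ with $B(\alpha)>0$ and $B(0)=B(1)=1$. The one-parameter Mittag-Leffler function is $\mathbb{E}_\alpha(z)=\sum_{n=0}^\infty \frac{z^n}{\Gamma(n\alpha+1)}$. For $\omega\in H^1(0,T)$ (Sobolev space), the left Atangana--Baleanu--Caputo (ABC) fractional derivative of order $\alpha$ is ${}^{ABC}{}_0\mathcal{D}_\tau^\alpha\omega(\tau)=\frac{B(\alpha)}{1-\alpha}\int_0^\tau \mathbb{E}_\alpha\left[-\frac{\alpha}{1-\alpha}(\tau-\sigma)^\alpha\right]\omega'(\sigma)\,d\sigma$. Functions to which this operator is applied are understood to lie in its domain. $C(J)$ denotes the real continuous functions on $J$. *)

(* Defs.v *)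
From HB Require Import structures.
From mathcomp Require Import all_boot all_order all_algebra.
From mathcomp Require Import all_classical all_reals all_analysis.

Set Implicit Arguments.
Unset Strict Implicit.
Unset Printing Implicit Defensive.

Import Order.TTheory GRing.Theory Num.Theory.
Import numFieldNormedType.Exports.

Local Open Scope classical_set_scope.
Local Open Scope ring_scope.

(* Real-variable functions are total functions R -> R; only their values on the
   interval under consideration are used. *)

Section Definitions.
Context {R : realType}.
Implicit Types (T a x z t : R) (u g phi : R -> R).

Local Notation mu := (@lebesgue_measure R).

(* Euler's Gamma function, meaningful for 0 < x. *)
Definition Gamma x : R :=
  \int[mu]_(t in `]0, +oo[) (t `^ (x - 1) * expR (- t)).

Definition mittag_leffler a z : R :=
  limn (series (fun n : nat => z ^+ n / Gamma (n%:R * a + 1))).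

(* One-sided at those end points of an interval A which belong to A. *)
Definition differentiable_on (A : set R) u : Prop :=
  forall t, A t ->
    cvg ((fun s : R => (u s - u t) / (s - t)) @ within (A `\ t) (nbhs t)).

Definition L2_0T T u : Prop :=
  (u \_ `]0, T[ : R -> R) \in Lfun mu 2%:E.

Definition test_function T phi : Prop :=
  [/\ forall (n : nat) x, derivable (phi^`(n)%classic) x 1,
      compact (closure [set x | phi x != 0]) &
      closure [set x | phi x != 0] `<=` `]0, T[ ].

Definition is_weak_derivative T u g : Prop :=
  forall phi, test_function T phi ->
    \int[mu]_(x in `]0, T[) (u x * phi^`()%classic x) =
    - \int[mu]_(x in `]0, T[) (g x * phi x).

Definition H1_0T T u : Prop :=
  L2_0T T u /\ exists2 g, L2_0T T g & is_weak_derivative T u g.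

(* A representative of the class u' in L^2(0, T) when H1_0T T u.  Two
   representatives agree almost everywhere on ]0, T[, so ABC_derivative below
   does not depend on the choice. *)
Definition weak_derivative T u : R -> R :=
  xget (fun=> 0) [set g | L2_0T T g /\ is_weak_derivative T u g].

Definition ABC_derivative (B : R -> R) a T u : R -> R := fun tau =>
  B a / (1 - a) *
  \int[mu]_(sigma in `[0, tau])
    (mittag_leffler a (- (a / (1 - a)) * (tau - sigma) `^ a)
     * weak_derivative T u sigma).

End Definitions.

(* Main.v *)
Require Import Defs.
From HB Require Import structures.
From mathcomp Require Import all_boot all_order all_algebra.
From mathcomp Require Import all_classical all_reals all_analysis.
From mathcomp Require Import measurable_realfun ring lra.
Import Order.TTheory GRing.Theory Num.Theory.
Import numFieldNormedType.Exports.
Local Open Scope classical_set_scope.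
Local Open Scope ring_scope.

(** Put m = v - w and suppose that m is positive somewhere. Let a be the
    supremum of the points up to which m is nonpositive, so that m a = 0, and
    let c be a maximum point of m on a short interval [a, a + d]; then m c > 0.
    Write K s for the Mittag-Leffler kernel of the derivative at time c, as a
    function of the lower variable s. It is nonnegative and nondecreasing on
    [0, c] and tends to 1 at c. Integration by parts gives, as K' >= 0, as m is
    nonpositive up to a and as m is at most m c between a and c,
      int_0^c K m' >= K a * m c,
    and K a > L (1 - alpha) / B(alpha) when d is small. But the differential
    inequalities and the one-sided Lipschitz condition bound the difference of
    the two derivatives at c, which is B(alpha) / (1 - alpha) times this
    integral, by L * m c: a contradiction.

    Three facts carry the argument.

    - The kernel: x |-> E_alpha(- x) is nonnegative and nonincreasing on the
      half-line (mittag_leffler_ge0, mittag_leffler_anti). It is a limit of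
      discretizations: the coefficient of z^n in
      (1 - z)^(alpha - 1) / ((1 - z)^alpha + mu), with mu = x (n + 1)^(- alpha),
      is a power series in x whose terms converge to those of the
      Mittag-Leffler series by Euler's limit formula for Gamma
      (cvg_scaled_negbin), hence also its sum by Tannery's theorem
      (cvg_lim_series_half). These coefficients are nonnegative and
      nonincreasing in mu, because all the coefficients of (1 - z)^alpha but the
      first are nonpositive, so that they obey a recurrence with nonnegative
      weights (relax_rec).

    - The weak derivative: a continuous function in H^1 is the primitive of its
      weak derivative (weak_FTC). This is tested on differences of two smooth
      steps, built from exp(- 1 / x), that shrink to the indicator of an
      interval.

    - Integration by parts with a monotone weight, for a density that is only
      integrable: the weight is approximated by sums of indicators of upper
      subintervals (monotone_weight_ge0, monotone_weight_lower_bound). *)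

(** * Binomial series *)

Section Binomial.
Set Implicit Arguments.
Unset Strict Implicit.
Unset Printing Implicit Defensive.
Context {R : realType}.
Implicit Types (a b mu : R) (n k j : nat).

(** The coefficient of z^n in the binomial series of (1 - z)^(-a). *)
Definition negbin a n : R := \prod_(i < n) ((a + i%:R) / i.+1%:R).

Lemma negbin0 a : negbin a 0 = 1.
Proof. by rewrite /negbin big_ord0. Qed.

Lemma negbinS a n : n.+1%:R * negbin a n.+1 = (a + n%:R) * negbin a n.
Proof.
rewrite /negbin big_ord_recr /=.
have : (n.+1%:R : R) != 0 by rewrite pnatr_eq0.
by move=> ?; field.
Qed.

Lemma negbin_ge0 a n : 0 <= a -> 0 <= negbin a n.
Proof.
by move=> a0; apply: prodr_ge0 => i _; rewrite divr_ge0 ?addr_ge0.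
Qed.

Lemma negbinN_le0 a n : 0 <= a <= 1 -> negbin (- a) n.+1 <= 0.
Proof.
case/andP=> a0 a1; rewrite /negbin big_ord_recl/=.
rewrite mulr_le0_ge0 ?addr0 ?divr1 ?oppr_le0//.
apply: prodr_ge0 => i _; rewrite divr_ge0// /bump/= add1n.
by rewrite addrC subr_ge0 (le_trans a1)// ler1n.
Qed.

(** The Chu-Vandermonde identity: (1 - z)^(-a) (1 - z)^(-b) = (1 - z)^(-a-b). *)
Lemma sum_negbin a b n :
  \sum_(k < n.+1) negbin a k * negbin b (n - k) = negbin (a + b) n.
Proof.
elim: n => [|n IHn]; first by rewrite big_ord1 !negbin0 mulr1.
have n0 : (n.+1%:R : R) != 0 by rewrite pnatr_eq0.
apply: (mulfI n0); rewrite negbinS -IHn mulr_sumr.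
(* Split the factor n + 1 as k + (n + 1 - k) and use the recurrence of
   negbin in each factor. *)
transitivity (\sum_(k < n.+2) (k%:R * negbin a k * negbin b (n.+1 - k)) +
   \sum_(k < n.+2) (negbin a k * ((n.+1 - k)%:R * negbin b (n.+1 - k)))).
  rewrite -big_split/=; apply: eq_bigr => k _.
  have {1}-> : n.+1 = (k + (n.+1 - k))%N by rewrite subnKC// -ltnS.
  by rewrite natrD; ring.
rewrite big_ord_recl/= mul0r mul0r add0r.
rewrite [X in _ + X]big_ord_recr/= subnn mul0r mulr0 addr0 -big_split/=.
rewrite mulr_sumr; apply: eq_bigr => k _.
have kn : (k <= n)%N by rewrite -ltnS.
rewrite /bump/= add1n subSS subSn// !negbinS natrB//.
ring.
Qed.

(** The factors 1 + b / (k + 1) are at most n + 1 times 1 + b / (n + 1), hence at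
    most (n + 1) exp(b / (n + 1)): for fixed n the growth in b is only e^b. *)
Lemma negbin_le_exp b n : 0 <= b ->
  negbin (1 + b) n <= n.+1%:R ^+ n * expR b.
Proof.
move=> b0.
have H k : (k <= n)%N -> negbin (1 + b) k <= n.+1%:R ^+ k * expR (b / n.+1%:R *+ k).
  elim: k => [|k IHk] kn; first by rewrite negbin0 mulr0n expR0 expr0 mulr1.
  rewrite /negbin big_ord_recr/= -/(negbin _ _) [_ / _ *+ _]mulrSr expRD.
  have -> : n.+1%:R ^+ k.+1 * (expR (b / n.+1%:R *+ k) * expR (b / n.+1%:R)) =
    (n.+1%:R ^+ k * expR (b / n.+1%:R *+ k)) * (n.+1%:R * expR (b / n.+1%:R)).
    by rewrite exprSr; ring.
  have k0 : (0 : R) < k.+1%:R by rewrite ltr0n.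
  have n0 : (0 : R) < n.+1%:R by rewrite ltr0n.
  apply: ler_pM; [by rewrite negbin_ge0// addr_ge0| |exact/IHk/ltnW|].
    by rewrite divr_ge0// !addr_ge0.
  have -> : (1 + b + k%:R) / k.+1%:R = 1 + b / k.+1%:R.
    by rewrite -[in LHS]addrA [b + _]addrC addrA -natr1 [1+k%:R]addrC mulrDl divff// natr1 gt_eqF.
  apply: (@le_trans _ _ (n.+1%:R * (1 + b / n.+1%:R))).
    rewrite mulrDr mulr1 mulrCA divff ?gt_eqF// mulr1 lerD ?ler1n//.
    by rewrite ler_pdivrMr// ler_peMr// ler1n.
  by rewrite ler_pM2l// expR_ge1Dx.
apply: (le_trans (H n (leqnn n))); rewrite ler_pM2l ?exprn_gt0//.
rewrite ler_expR -mulr_natr -mulrA ler_piMr// mulrC ler_pdivrMr ?mul1r ?ler_nat//.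
Qed.

End Binomial.

(** * Discretized relaxation *)

Section Series.
Set Implicit Arguments.
Unset Strict Implicit.
Unset Printing Implicit Defensive.
Context {R : realType}.
Implicit Types (u : nat -> R) (C a b mu : R) (n k j : nat).

Lemma sum_geometric_half J n :
  \sum_(J <= k < J + n) 2^-1 ^+ k <= 2 * 2^-1 ^+ J :> R.
Proof.
have -> : \sum_(J <= k < J + n) 2^-1 ^+ k = 2 * 2^-1 ^+ J - 2 * 2^-1 ^+ (J + n) :> R.
  elim: n => [|n IHn]; first by rewrite addn0 big_geq// subrr.
  rewrite addnS big_nat_recr ?leq_addr//= IHn exprS.
  by field.
by rewrite lerBlDr lerDl mulr_ge0// exprn_ge0// invr_ge0.
Qed.

Lemma cvg_series_half u C : (forall j, `|u j| <= C * 2^-1 ^+ j) ->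
  cvgn (series u).
Proof.
move=> uC; apply: normed_cvg.
apply: (@series_le_cvg _ _ (geometric C 2^-1)) => [j|j|j|].
- exact: normr_ge0.
- exact: le_trans (normr_ge0 _) (uC j).
- exact: uC.
- by apply: is_cvg_geometric_series; rewrite ger0_norm ?invr_ge0// invf_lt1// ltr1n.
Qed.

Lemma series_half_tail u C J n : (forall j, `|u j| <= C * 2^-1 ^+ j) ->
  (J <= n)%N -> `|series u n - series u J| <= 2 * C * 2^-1 ^+ J.
Proof.
move=> uC Jn; rewrite sub_series Jn.
apply: (le_trans (ler_norm_sum _ _ _)).
apply: (le_trans (ler_sum _ (fun i _ => uC i))).
rewrite -mulr_sumr -(subnKC Jn).
have C0 : 0 <= C by have := le_trans (normr_ge0 _) (uC 0%N); rewrite expr0 mulr1.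
by rewrite [2 * C]mulrC -mulrA ler_wpM2l// sum_geometric_half.
Qed.

Lemma lim_series_half_tail u C J : (forall j, `|u j| <= C * 2^-1 ^+ j) ->
  `|limn (series u) - series u J| <= 2 * C * 2^-1 ^+ J.
Proof.
move=> uC; have cu := cvg_series_half uC.
have H : (fun n => `|series u n - series u J|) @ \oo --> `|limn (series u) - series u J|.
  by apply: cvg_norm; apply: cvgB; [exact: cu|exact: cvg_cst].
rewrite -(cvg_lim _ H)//; apply: limr_le; first by apply/cvg_ex; eexists; exact: H.
near=> n; apply: series_half_tail => //; near: n; exact: nbhs_infty_ge.
Unshelve. all: by end_near. Qed.

(** Tannery's theorem: under a common summable bound the sum of a series and
    a limit of its terms can be interchanged. *)
Lemma cvg_lim_series_half (u : nat -> nat -> R) (l : nat -> R) C :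
  (\forall n \near \oo, forall j, `|u n j| <= C * 2^-1 ^+ j) ->
  (forall j, u n j @[n --> \oo] --> l j) ->
  cvgn (series l) /\ limn (series (u n)) @[n --> \oo] --> limn (series l).
Proof.
move=> uC ul.
have lC j : `|l j| <= C * 2^-1 ^+ j.
  have H : `|u n j| @[n --> \oo] --> `|l j| by apply: cvg_norm; exact: ul.
  rewrite -(cvg_lim _ H)//; apply: limr_le; first by apply/cvg_ex; eexists; exact: H.
  by near do idtac; apply: filterS uC => n; exact.
split; first exact: cvg_series_half lC.
apply/cvgrPdist_lt => e e0.
have C0 : 0 <= C by have := le_trans (normr_ge0 _) (lC 0%N); rewrite expr0 mulr1.
have [J HJ] : exists J, 2 * C * 2^-1 ^+ J < e / 3.
  have h : geometric (2 * C) 2^-1 @ \oo --> (0 : R).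
    by apply: cvg_geometric; rewrite ger0_norm ?invr_ge0// invf_lt1// ltr1n.
  have e3 : 0 < e / 3 by rewrite divr_gt0.
  move/cvgrPdist_lt : h => /(_ _ e3)[J _ HJ]; exists J.
  have := HJ J (leqnn J); rewrite /= sub0r normrN ger0_norm//.
  by rewrite !mulr_ge0// exprn_ge0// invr_ge0.
have HS : series (u n) J @[n --> \oo] --> series l J.
  by apply: cvg_big => [|j _]; [exact: add_continuous|exact: ul].
have e3 : 0 < e / 3 by rewrite divr_gt0.
near=> n.
have h1 := lim_series_half_tail J lC.
have h2 : `|limn (series (u n)) - series (u n) J| <= 2 * C * 2^-1 ^+ J.
  by apply: lim_series_half_tail; near: n.
have h3 : `|series l J - series (u n) J| < e / 3.
  by near: n; move/cvgrPdist_lt : HS; exact.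
rewrite (_ : _ - _ = (limn (series l) - series l J) + (series l J - series (u n) J)
   - (limn (series (u n)) - series (u n) J)); last ring.
apply: (le_lt_trans (ler_normB _ _)).
have -> : e = e / 3 + e / 3 + e / 3 by field.
rewrite ltrD// ?(le_lt_trans h2)//.
by apply: (le_lt_trans (ler_normD _ _)); rewrite ltrD// (le_lt_trans h1).
Unshelve. all: by end_near. Qed.

(** The series of these terms is the coefficient of z^n in
    (1 - z)^(a - 1) / ((1 - z)^a + mu), expanded in powers of mu. It is the
    n-th value of the Grunwald-Letnikov discretization, with step mu^(1/a), of
    the fractional relaxation equation solved by E_a(- t^a). *)
Definition relax_term a mu n : nat -> R :=
  fun j => (- mu) ^+ j * negbin (1 + a * j%:R) n.

Definition relax a mu n := limn (series (relax_term a mu n)).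

(** The growth e^(a j) of the coefficients costs a factor e at each step in j,
    which is why mu is kept below e^(-1) / 2. *)
Lemma relax_term_le a mu n j : 0 <= a <= 1 -> 0 <= mu <= expR (-1) / 2 ->
  `|relax_term a mu n j| <= n.+1%:R ^+ n * 2^-1 ^+ j.
Proof.
case/andP=> a0 a1 /andP[m0 m1].
have aj0 : 0 <= a * j%:R by rewrite mulr_ge0.
rewrite /relax_term normrM normrX normrN (ger0_norm m0) ger0_norm; last first.
  by rewrite negbin_ge0// addr_ge0.
apply: (@le_trans _ _ (mu ^+ j * (n.+1%:R ^+ n * expR j%:R))).
  rewrite ler_wpM2l ?exprn_ge0//.
  apply: (le_trans (negbin_le_exp _ aj0)).
  by rewrite ler_wpM2l ?exprn_ge0// ler_expR ler_piMl.
rewrite mulrCA ler_wpM2l ?exprn_ge0//.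
rewrite -[X in expR X]mulr1 mulrC expRM_natl -exprMn lerXn2r ?nnegrE ?invr_ge0//.
  by rewrite mulr_ge0// expR_ge0.
rewrite (@le_trans _ _ (expR 1 * (expR (-1) / 2)))//.
  by rewrite ler_wpM2l// expR_ge0.
by rewrite mulrA -expRD subrr expR0 mul1r.
Qed.

(** Multiplying the generating function by (1 - z)^a + mu gives a recurrence
    whose coefficients - negbin (- a) k, for k > 0, are nonnegative. *)
Lemma relax_rec a mu n : 0 <= a <= 1 -> 0 <= mu <= expR (-1) / 2 ->
  (1 + mu) * relax a mu n = negbin (1 - a) n +
    \sum_(k < n) - negbin (- a) k.+1 * relax a mu (n - k.+1).
Proof.
move=> ha hm.
have cY m : series (relax_term a mu m) @ \oo --> relax a mu m.
  by apply: cvg_series_half => j; exact: (relax_term_le _ _ ha hm).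
have E M : \sum_(k < n.+1) negbin (- a) k * series (relax_term a mu (n - k)) M.+1 =
    negbin (1 - a) n - mu * series (relax_term a mu n) M.
  rewrite /series/=.
  transitivity (\sum_(0 <= j < M.+1) (- mu) ^+ j * negbin (1 + a * j%:R - a) n).
    under eq_bigr do rewrite mulr_sumr.
    rewrite exchange_big/=; apply: eq_bigr => j _.
    rewrite addrC -sum_negbin mulr_sumr; apply: eq_bigr => k _.
    by rewrite /relax_term mulrCA.
  rewrite big_nat_recl//= expr0 mul1r mulr0 addr0; congr (_ + _).
  rewrite -mulNr mulr_sumr; apply: eq_bigr => j _.
  rewrite exprS -mulrA /relax_term; congr (_ * (_ * negbin _ _)).
  by rewrite -natr1 mulrDr mulr1; ring.
have h1 : (fun M => \sum_(k < n.+1) negbin (- a) k * series (relax_term a mu (n - k)) M.+1)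
    @ \oo --> \sum_(k < n.+1) negbin (- a) k * relax a mu (n - k).
  apply: cvg_big => [|k _]; first exact: add_continuous.
  apply: cvgMl_tmp.
  by have := cY (n - k)%N; rewrite -cvg_shiftS.
have h2 : (fun M => \sum_(k < n.+1) negbin (- a) k * series (relax_term a mu (n - k)) M.+1)
    @ \oo --> negbin (1 - a) n - mu * relax a mu n.
  rewrite (funext E); apply: cvgB; first exact: cvg_cst.
  by apply: cvgMl_tmp; exact: cY.
have := cvg_unique _ h1 h2.
move=> /(_ (@Rhausdorff R)); rewrite big_ord_recl/= negbin0 mul1r subn0 => e.
under eq_bigr do rewrite mulNr.
rewrite sumrN mulrDl mul1r -[negbin _ _](subrK (mu * relax a mu n)) -e.
by rewrite [in RHS]addrAC addrK.
Qed.

Lemma relax_ge0 a mu n : 0 <= a <= 1 -> 0 <= mu <= expR (-1) / 2 -> 0 <= relax a mu n.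
Proof.
move=> ha hm; have [a0 a1] := andP ha; have [m0 _] := andP hm.
elim/ltn_ind: n => n IHn.
have p : 0 < 1 + mu by lra.
rewrite -(pmulr_rge0 _ p) relax_rec// addr_ge0//.
  by rewrite negbin_ge0// subr_ge0.
apply: sumr_ge0 => k _; rewrite mulr_ge0//.
  by rewrite oppr_ge0 negbinN_le0.
by apply: IHn; rewrite ltn_subrL/=; exact: leq_ltn_trans (ltn_ord k).
Qed.

(** A larger mu only divides the recurrence by a larger 1 + mu. *)
Lemma relax_anti a mu nu n : 0 <= a <= 1 -> 0 <= mu -> mu <= nu -> nu <= expR (-1) / 2 ->
  relax a nu n <= relax a mu n.
Proof.
move=> ha m0 mn n1; have [a0 a1] := andP ha.
have hm : 0 <= mu <= expR (-1) / 2 by rewrite m0 (le_trans mn).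
have hn : 0 <= nu <= expR (-1) / 2 by rewrite (le_trans m0).
elim/ltn_ind: n => n IHn.
have p : 0 < 1 + nu by lra.
rewrite -(ler_pM2l p); apply: (@le_trans _ _ ((1 + mu) * relax a mu n)).
  rewrite !relax_rec// lerD2l; apply: ler_sum => k _.
  rewrite ler_wpM2l ?oppr_ge0 ?negbinN_le0//.
  by apply: IHn; rewrite ltn_subrL/=; exact: leq_ltn_trans (ltn_ord k).
by rewrite ler_wpM2r ?relax_ge0// lerD2l.
Qed.

End Series.

(** * Integrable functions *)

Section RealIntegrable.
Set Implicit Arguments.
Unset Strict Implicit.
Unset Printing Implicit Defensive.
Context d (T : measurableType d) {R : realType} (m : {measure set T -> \bar R}).
Implicit Types (D : set T) (f g : T -> R).

Lemma integrableDf D f g : measurable D ->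
  m.-integrable D (EFin \o f) -> m.-integrable D (EFin \o g) ->
  m.-integrable D (EFin \o (fun t => f t + g t)).
Proof. by move=> mD hf hg; apply: eq_integrable (integrableD mD hf hg). Qed.

Lemma integrableBf D f g : measurable D ->
  m.-integrable D (EFin \o f) -> m.-integrable D (EFin \o g) ->
  m.-integrable D (EFin \o (fun t => f t - g t)).
Proof. by move=> mD hf hg; apply: eq_integrable (integrableB mD hf hg). Qed.

Lemma integrableZf D (c : R) f : measurable D ->
  m.-integrable D (EFin \o f) -> m.-integrable D (EFin \o (fun t => c * f t)).
Proof. by move=> mD hf; apply: eq_integrable (integrableZl mD c hf). Qed.

End RealIntegrable.

Section IntegrableItv.
Context {R : realType}.
Local Notation mu := (@lebesgue_measure R).

Lemma integrable_open_closed (T : R) (g : R -> R) : mu.-integrable `]0, T[ (EFin \o g) ->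
  mu.-integrable `[0, T] (EFin \o g).
Proof.
case/integrableP => /measurable_EFinP mg ig.
have mgc : measurable_fun `[0, T] g.
  by apply/measurable_fun_itv_obnd_cbndP/measurable_fun_itv_bndo_bndcP.
apply/integrableP; split; first exact/measurable_EFinP.
rewrite integral_itv_bndoo//; apply: measurableT_comp => //.
exact/measurable_EFinP.
Qed.

End IntegrableItv.

(** * The Gamma function on [1, +oo[ *)

Section GammaFunction.
Set Implicit Arguments.
Unset Strict Implicit.
Unset Printing Implicit Defensive.
Context {R : realType}.
Implicit Types (x t p c th : R).
Local Notation mu := (@lebesgue_measure R).

(** The inequality 1 + y <= e^y at y = t / (2 x), raised to the power x. *)
Lemma powR_le_exp x t : 0 < x -> 0 <= t -> t `^ x <= (2 * x) `^ x * expR (t / 2).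
Proof.
move=> x0 t0; have x2 : 0 < 2 * x by rewrite mulr_gt0.
have -> : expR (t / 2) = expR (t / (2 * x)) `^ x.
  by rewrite -expRM; congr expR; field; exact: lt0r_neq0.
rewrite -powRM ?expR_ge0//; last exact: ltW.
rewrite (@ge0_ler_powR _ x (ltW x0))// ?nnegrE//.
  by rewrite mulr_ge0 ?expR_ge0// ltW.
rewrite mulrC -ler_pdivrMr//.
by rewrite (le_trans _ (expR_ge1Dx _))// lerDr.
Qed.

Lemma cvg_expRNM c : 0 < c -> expR (- (c * t)) @[t --> +oo%R] --> (0 : R).
Proof.
move=> c0; apply: (@cvg_comp _ _ _ (fun t => c * t) (fun y => expR (- y)) _ +oo%R).
  exact: gt0_cvgMry.
exact: cvgr_expR.
Qed.

Lemma is_deriveDf (f g : R -> R) x a b : is_derive x 1 f a -> is_derive x 1 g b ->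
  is_derive x 1 (fun t => f t + g t) (a + b).
Proof. exact: is_deriveD. Qed.

Lemma is_deriveNf (f : R -> R) x a : is_derive x 1 f a ->
  is_derive x 1 (fun t => - f t) (- a).
Proof. exact: is_deriveN. Qed.

Lemma is_deriveMf (f g : R -> R) x a b : is_derive x 1 f a -> is_derive x 1 g b ->
  is_derive x 1 (fun t => f t * g t) (f x * b + a * g x).
Proof. by move=> hf hg; rewrite [a * _]mulrC; exact: is_deriveM. Qed.

Lemma is_deriveZf (f : R -> R) c x a : is_derive x 1 f a ->
  is_derive x 1 (fun t => c * f t) (c * a).
Proof. exact: is_deriveZ. Qed.

Lemma derive_expRNM c t : is_derive t 1 (fun t => expR (- (c * t))) (- c * expR (- (c * t))).
Proof.
have h : is_derive t 1 (fun t => - (c * t)) (- c).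
  apply: is_deriveNf; rewrite -[X in is_derive _ _ _ X]mulr1.
  by apply: is_deriveZf; exact: is_derive_id.
by rewrite mulrC; exact: is_derive1_comp (is_derive_expR _) h.
Qed.

Definition Gamma_integrand x t : R := t `^ (x - 1) * expR (- t).

Lemma Gamma_integrand_ge0 x t : 0 <= Gamma_integrand x t.
Proof. by rewrite mulr_ge0 ?powR_ge0 ?expR_ge0. Qed.

Lemma powR_cvg_at_right0 p : 0 <= p -> t `^ p @[t --> 0^'+] --> (0 : R) `^ p.
Proof.
rewrite le_eqVlt => /predU1P[<-|p0]; last by rewrite powR0 ?gt_eqF//; exact: powR_cvg0.
by rewrite powRr0; under eq_cvg do rewrite powRr0; exact: cvg_cst.
Qed.

Lemma derive_continuous_itvcy (f : R -> R) (df : R -> R) :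
  (forall t, 0 < t -> is_derive t 1 f (df t)) ->
  f t @[t --> 0^'+] --> f 0 -> {within `[0, +oo[, continuous f}.
Proof.
move=> fdf f0; apply/continuous_within_itvcyP; split => // t.
rewrite in_itv/= andbT => t0.
by apply/differentiable_continuous/derivable1_diffP; case: (fdf _ t0).
Qed.

Lemma measurable_Gamma_integrand x : measurable_fun (`]0, +oo[ : set R) (Gamma_integrand x).
Proof.
apply: open_continuous_measurable_fun => // t; rewrite inE/= in_itv/= andbT => t0.
apply/differentiable_continuous/derivable1_diffP.
have h := is_derive1_powR (x - 1) t0.
have h2 := derive_expRNM 1 t.
case: (is_deriveMf h h2) => + _.
by rewrite (_ : (fun t => _) = Gamma_integrand x)//; apply/funext => s; rewrite mul1r.
Qed.

Lemma integral_expRNM c : 0 < c ->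
  (\int[mu]_(t in `[0%R, +oo[) (expR (- (c * t)))%:E = (c^-1)%:E)%E.
Proof.
move=> c0; pose F t := - (c^-1 * expR (- (c * t))).
have dF t : is_derive t 1 F (expR (- (c * t))).
  rewrite (_ : expR _ = - (c^-1 * (- c * expR (- (c * t))))); last first.
    by field; exact: lt0r_neq0.
  by apply: is_deriveNf; apply: is_deriveZf; exact: derive_expRNM.
have cvF (f df : R -> R) : (forall t, is_derive t 1 f (df t)) -> continuous f.
  move=> fdf t; apply/differentiable_continuous/derivable1_diffP.
  by case: (fdf t).
rewrite (@ge0_continuous_FTC2y _ (fun t => expR (- (c * t))) F 0 0) => [|t _||||| t _].
- by rewrite /F mulr0 oppr0 expR0 mulr1 sub0e EFinN oppeK.
- exact: expR_ge0.
- by apply: continuous_subspaceT; exact: cvF (derive_expRNM c).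
- rewrite -oppr0 -[X in - X](mulr0 c^-1); apply: cvgN; apply: cvgMl_tmp.
  exact: cvg_expRNM.
- by move=> t _; case: (dF t).
- by apply: cvg_at_right_filter; exact: cvF dF 0.
- by rewrite derive1E; have [_ ->] := dF t.
Qed.

Lemma integrable_expRNM c : 0 < c ->
  mu.-integrable `]0, +oo[ (fun t => (expR (- (c * t)))%:E).
Proof.
move=> c0.
apply: (@integrableS _ _ _ mu `[0, +oo[) => //; first by move=> t /=; rewrite !in_itv/= !andbT => /ltW.
apply/integrableP; split.
  apply/measurable_EFinP; apply: measurable_funTS; apply: continuous_measurable_fun.
  move=> t; apply/differentiable_continuous/derivable1_diffP.
  by case: (derive_expRNM c t).
under eq_integral do rewrite gee0_abs ?lee_fin ?expR_ge0//.
by rewrite integral_expRNM// ltry.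
Qed.

Lemma integrable_Gamma_integrand x : 1 <= x ->
  mu.-integrable `]0, +oo[ (EFin \o Gamma_integrand x).
Proof.
rewrite le_eqVlt => /predU1P[<-|x1].
  apply: eq_integrable (integrable_expRNM ltr01) => // t _.
  by rewrite /= /Gamma_integrand subrr powRr0 !mul1r.
have p0 : 0 < x - 1 by rewrite subr_gt0.
pose C := (2 * (x - 1)) `^ (x - 1).
have h2 : 0 < 2^-1 :> R by rewrite invr_gt0.
apply: (@le_integrable _ _ _ mu _ _ _ (fun t => C%:E * (expR (- (2^-1 * t)))%:E)%E) => //; last first.
  by apply: integrableZl => //; exact: integrable_expRNM.
  move=> t /=; rewrite in_itv/= andbT => t0.
  rewrite lee_fin !ger0_norm ?Gamma_integrand_ge0 ?mulr_ge0 ?powR_ge0 ?expR_ge0//.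
  rewrite /Gamma_integrand (le_trans (ler_wpM2r (expR_ge0 _) (powR_le_exp p0 (ltW t0))))//.
  by rewrite -mulrA -expRD (_ : t / 2 - t = - (2^-1 * t))//; field.
by apply/measurable_EFinP; exact: measurable_Gamma_integrand.
Qed.

Lemma integrable_Gamma_integrandZ c x : 1 <= x ->
  mu.-integrable `]0, +oo[ (EFin \o (fun t => c * Gamma_integrand x t)).
Proof.
by move=> /integrable_Gamma_integrand; exact: integrableZf.
Qed.

Lemma Gamma1 : Gamma 1 = 1 :> R.
Proof.
rewrite /Gamma Rintegral_itv_obnd_cbnd; last exact: integrable_Gamma_integrand.
rewrite /Rintegral; under eq_integral do rewrite subrr powRr0 mul1r -[X in - X]mul1r.
by rewrite integral_expRNM// invr1.
Qed.

(** Integration by parts in the form of the fundamental theorem applied to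
    F = - (t^x + C) e^(-t): the constant C makes F nondecreasing, so that the
    version for nonnegative integrands on a half-line applies. *)
Lemma GammaD1 x : 1 <= x -> Gamma (x + 1) = x * Gamma x.
Proof.
move=> x1; have x0 : 0 < x by rewrite (lt_le_trans ltr01).
have p0 : 0 <= x - 1 by rewrite subr_ge0.
pose C := x `^ x.
pose F t := - ((t `^ x + C) * expR (- t)).
pose f t := (t `^ x + C - x * t `^ (x - 1)) * expR (- t).
have dE t : is_derive t 1 (fun t => expR (- t)) (- expR (- t)).
  have := derive_expRNM 1 t; rewrite mulN1r mul1r.
  by under eq_fun do rewrite mul1r.
have cE : expR (- t) @[t --> 0^'+] --> expR (- (0 : R)).
  have cE : continuous (fun t : R => expR (- t)).
    move=> t; apply/differentiable_continuous/derivable1_diffP.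
    by case: (dE t).
  by apply: cvg_at_right_filter; exact: cE.
have dF t : 0 < t -> is_derive t 1 F (f t).
  move=> t0.
  rewrite (_ : f t = - ((t `^ x + C) * - expR (- t) + (x * t `^ (x - 1) + 0) * expR (- t))); last first.
    by rewrite /f; ring.
  exact: is_deriveNf (is_deriveMf (is_deriveDf (is_derive1_powR x t0)
    (is_derive_cst C t 1)) (dE t)).
have F0 : F t @[t --> 0^'+] --> F 0.
  apply: cvgN; apply: cvgM => //; apply: cvgD; last exact: cvg_cst.
  by apply: powR_cvg_at_right0; exact: ltW.
have Foo : F t @[t --> +oo] --> (0 : R).
  have h2 : 0 < 2^-1 :> R by rewrite invr_gt0.
  pose D := (2 * x) `^ x.
  have h : - (D * expR (- (2^-1 * t)) + C * expR (- (1 * t))) @[t --> +oo] -->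
      - (D * 0 + C * 0).
    by apply: cvgN; apply: cvgD; apply: cvgMl_tmp; exact: cvg_expRNM.
  rewrite !mulr0 addr0 oppr0 in h.
  apply: (squeeze_cvgr _ h (cvg_cst 0)); near=> t.
  have t0 : 0 <= t by near: t; exact: nbhs_pinfty_ge.
  rewrite oppr_le0 mulr_ge0 ?expR_ge0 ?addr_ge0 ?powR_ge0// andbT.
  rewrite lerN2 mulrDl mul1r lerD2r.
  apply: (le_trans (ler_wpM2r (expR_ge0 _) (powR_le_exp x0 t0))).
  by rewrite -mulrA -expRD (_ : t / 2 - t = - (2^-1 * t))//; field.
have f_ge0 t : 0 <= t -> 0 <= f t.
  move=> t0; rewrite mulr_ge0 ?expR_ge0// subr_ge0.
  have [tx|xt] := leP t x.
    rewrite ler_wpDl ?powR_ge0// /C -(mulr_powRB1 (ltW x0) x0) ler_wpM2l ?(ltW x0)//.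
    by rewrite (ge0_ler_powR p0)// ?nnegrE// ltW.
  rewrite ler_wpDr ?powR_ge0// -(mulr_powRB1 t0 x0) ler_wpM2r ?powR_ge0//.
  exact: ltW.
have cf : {within `[0, +oo[, continuous f}.
  apply: derive_continuous_itvcy.
    move=> t t0; exact: is_deriveMf (is_deriveDf (is_deriveDf (is_derive1_powR x t0)
      (is_derive_cst C t 1)) (is_deriveNf (is_deriveZf x (is_derive1_powR (x - 1) t0))))
      (dE t).
  apply: cvgM => //; apply: cvgB.
    by apply: cvgD; [apply: powR_cvg_at_right0; exact: ltW|exact: cvg_cst].
  by apply: cvgMl_tmp; exact: powR_cvg_at_right0.
have I1 := @integrable_Gamma_integrand (x + 1).
have I2 := integrable_Gamma_integrand x1.
have I0 := integrable_Gamma_integrand (lexx 1).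
have x11 : 1 <= x + 1 by rewrite lerDr ltW.
have fE t : f t = Gamma_integrand (x + 1) t + C * Gamma_integrand 1 t - x * Gamma_integrand x t.
  rewrite /f /Gamma_integrand subrr powRr0 addrK; ring.
have iD : mu.-integrable `]0, +oo[
   (EFin \o (fun t => Gamma_integrand (x + 1) t + C * Gamma_integrand 1 t)).
  by apply: integrableDf => //; [exact: I1|exact: integrable_Gamma_integrandZ].
have dFx t : 0 < t -> derivable F t 1 by move=> /dF[].
have H := Rintegral_ge0_continuous_FTC2y f_ge0 cf Foo dFx F0.
have : \int[mu]_(t in `]0, +oo[) f t = C.
  rewrite Rintegral_itv_obnd_cbnd.
    rewrite H.
      by rewrite /F powR0 ?gt_eqF// oppr0 expR0; ring.
    move=> t; rewrite in_itv/= andbT => t0; rewrite derive1E.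
    by have [_ ->] := dF t t0.
  rewrite (funext fE).
  by apply: integrableBf => //; exact: integrable_Gamma_integrandZ.
rewrite (funext fE) RintegralB//; last exact: integrable_Gamma_integrandZ.
rewrite RintegralD//; [|exact: I1|exact: integrable_Gamma_integrandZ].
rewrite !RintegralZl//.
have GE y : \int[mu]_(t in `]0, +oo[) Gamma_integrand y t = Gamma y by [].
by rewrite !GE Gamma1 mulr1 => /eqP; rewrite subr_eq [X in X == _]addrC => /eqP/addrI.
Unshelve. all: by end_near. Qed.

(** Weighted arithmetic-geometric mean inequality. *)
Lemma powR_le_affine t th : 0 <= t -> 0 <= th <= 1 -> t `^ th <= th * t + (1 - th).
Proof.
rewrite le_eqVlt => /predU1P[<-|t0] /andP[th0 th1].
  rewrite mulr0 add0r; have [->|h] := eqVneq th 0; first by rewrite powRr0 subr0.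
  by rewrite powR0// subr_ge0.
have := @convex_expR _ (Itv01 th0 th1) (ln t) 0.
by rewrite /powR gt_eqF// !convRE/= expR0 mulr0 addr0 mulr1 lnK ?posrE.
Qed.

(** Wendel's inequality: integrate t^th x^(1-th) <= th t + (1-th) x against
    the Gamma density. *)
Lemma Gamma_wendel x th : 1 <= x -> 0 <= th <= 1 -> Gamma (x + th) <= x `^ th * Gamma x.
Proof.
move=> x1 /[dup] th01 /andP[th0 th1]; have x0 : 0 < x by rewrite (lt_le_trans ltr01).
have x11 : 1 <= x + 1 by rewrite lerDr ltW.
have xth1 : 1 <= x + th by rewrite (le_trans x1)// lerDl.
pose g t := x `^ th * (th / x) * Gamma_integrand (x + 1) t +
            x `^ th * (1 - th) * Gamma_integrand x t.
have ig : mu.-integrable `]0, +oo[ (EFin \o g).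
  by apply: integrableDf => //; exact: integrable_Gamma_integrandZ.
apply: (@le_trans _ _ (\int[mu]_(t in `]0, +oo[) g t)).
  apply: le_Rintegral => //; first exact: integrable_Gamma_integrand.
  move=> t /=; rewrite in_itv/= andbT => t0.
  rewrite /g /Gamma_integrand !mulrA -mulrDl ler_wpM2r ?expR_ge0//.
  rewrite (_ : x + th - 1 = x - 1 + th); last ring.
  rewrite powRD ?(gt_eqF t0) ?implybT// addrK -(mulr_powRB1 (ltW t0) x0).
  have h := powR_le_affine (ltW (divr_gt0 t0 x0)) th01.
  have := ler_wpM2l (mulr_ge0 (powR_ge0 x th) (powR_ge0 t (x - 1))) h.
  have -> : x `^ th * t `^ (x - 1) * (t / x) `^ th = t `^ (x - 1) * t `^ th.
    rewrite mulrAC -powRM ?divr_ge0 ?ltW//.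
    by rewrite [x * _]mulrC divfK ?gt_eqF// mulrC.
  move=> /le_trans; apply; rewrite le_eqVlt; apply/orP; left; apply/eqP; ring.
rewrite /g RintegralD//; [|exact: integrable_Gamma_integrandZ|exact: integrable_Gamma_integrandZ].
rewrite !RintegralZl//; [|exact: integrable_Gamma_integrand|exact: integrable_Gamma_integrand].
have GE y : \int[mu]_(t in `]0, +oo[) Gamma_integrand y t = Gamma y by [].
rewrite !GE GammaD1// le_eqVlt; apply/orP; left; apply/eqP; field.
exact: lt0r_neq0.
Qed.

Lemma Gamma_gt0 x : 1 <= x -> 0 < Gamma x.
Proof.
move=> x1.
have base th : 0 <= th <= 1 -> 0 < Gamma (1 + th).
  move=> /andP[th0 th1].
  have h1 : 1 <= 1 + th by rewrite lerDl.
  have hth : 0 <= 1 - th <= 1 by rewrite subr_ge0 th1/= gerBl.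
  have := Gamma_wendel h1 hth.
  rewrite (_ : 1 + th + (1 - th) = 1 + 1); last ring.
  rewrite GammaD1// Gamma1 mulr1 => /(lt_le_trans ltr01).
  by rewrite pmulr_rgt0// powR_gt0// (lt_le_trans ltr01).
have [n xn] : exists n : nat, x - 1 <= n%:R.
  by exists (Num.bound (x - 1)); rewrite ltW// archi_boundP// subr_ge0.
elim: n x x1 xn => [|n IHn] x x1 xn.
  have -> : x = 1 + (x - 1) by ring.
  by apply: base; rewrite subr_ge0 x1 (le_trans xn).
have [x2|x2] := leP x 2.
  have -> : x = 1 + (x - 1) by ring.
  by apply: base; rewrite subr_ge0 x1/=; lra.
have -> : x = (x - 1) + 1 by ring.
have h : 1 <= x - 1 by lra.
rewrite GammaD1// mulr_gt0//; first lra.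
by apply: IHn => //; move: xn; rewrite -natr1; lra.
Qed.

End GammaFunction.

(** * The Mittag-Leffler function on the negative half-line *)

Section MittagLeffler.
Set Implicit Arguments.
Unset Strict Implicit.
Unset Printing Implicit Defensive.
Context {R : realType}.
Implicit Types (a b x y : R) (n N j : nat).

Lemma negbin_Gamma b n : 0 <= b ->
  n`!%:R * Gamma (1 + b) * negbin (1 + b) n = Gamma (n.+1%:R + b).
Proof.
move=> b0; elim: n => [|n IHn]; first by rewrite negbin0 fact0 mul1r mulr1.
have -> : n.+1`!%:R * Gamma (1 + b) * negbin (1 + b) n.+1 =
    (1 + b + n%:R) * (n`!%:R * Gamma (1 + b) * negbin (1 + b) n).
  rewrite factS natrM; transitivity (n`!%:R * Gamma (1 + b) * (n.+1%:R * negbin (1 + b) n.+1)).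
    by ring.
  by rewrite negbinS; ring.
have -> : n.+2%:R + b = n.+1%:R + b + 1 by rewrite -[n.+2%:R]natr1 addrAC.
rewrite IHn GammaD1.
  by congr (_ * _); rewrite -natr1; ring.
by rewrite (@le_trans _ _ n.+1%:R) ?ler1n// lerDl.
Qed.

(** For b = a j and mu = x (n + 1)^(- a) this is the coefficient of (- x)^j in
    the discretized series; it tends to the Mittag-Leffler coefficient. *)
Definition scaled_negbin b n : R := negbin (1 + b) n * n.+1%:R `^ (- b).

Lemma scaled_negbin_ge0 b n : 0 <= b -> 0 <= scaled_negbin b n.
Proof. by move=> b0; rewrite mulr_ge0 ?powR_ge0// negbin_ge0// addr_ge0. Qed.

Lemma GammaS_nat n : Gamma n.+1%:R = n`!%:R :> R.
Proof.
elim: n => [|n IHn]; first by rewrite Gamma1 fact0.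
by rewrite -natr1 GammaD1 ?ler1n// IHn factS natrM.
Qed.

(** Both bounds are Wendel's inequality: between Gamma (n + 1) and
    Gamma (n + 1 + b), and between Gamma (n + 1 + b) and Gamma (n + 2). *)
Lemma scaled_negbin_bounds b n : 0 <= b <= 1 ->
  n.+1%:R / (n.+1%:R + b) <= scaled_negbin b n * Gamma (1 + b) <= 1.
Proof.
move=> /[dup] b01 /andP[b0 b1].
have n0 : 0 < n.+1%:R :> R by rewrite ltr0n.
have n1 : 1 <= n.+1%:R :> R by rewrite ler1n.
have f0 : 0 < n`!%:R :> R by rewrite ltr0n fact_gt0.
have p0 : 0 < n.+1%:R `^ b :> R by rewrite powR_gt0.
have nb0 : 0 < n.+1%:R + b by rewrite ltr_wpDr.
have E : scaled_negbin b n * Gamma (1 + b) =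
    Gamma (n.+1%:R + b) / (n`!%:R * n.+1%:R `^ b).
  rewrite -negbin_Gamma// /scaled_negbin powRN; field.
  by rewrite !lt0r_neq0.
rewrite E; apply/andP; split; last first.
  rewrite ler_pdivrMr ?mulr_gt0// mul1r mulrC.
  by have := Gamma_wendel n1 b01; rewrite GammaS_nat.
have hb : 0 <= 1 - b <= 1 by rewrite subr_ge0 b1/= gerBl.
have nb1 : 1 <= n.+1%:R + b by rewrite (le_trans n1)// lerDl.
have := Gamma_wendel nb1 hb.
rewrite (_ : n.+1%:R + b + (1 - b) = n.+1%:R + 1); last ring.
rewrite GammaD1// GammaS_nat => H.
rewrite ler_pdivlMr ?mulr_gt0//.
rewrite mulrAC ler_pdivrMr// mulrA.
apply: (@le_trans _ _ (((n.+1%:R + b) `^ (1 - b) * Gamma (n.+1%:R + b)) * n.+1%:R `^ b)).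
  by rewrite ler_wpM2r// powR_ge0.
rewrite [_ `^ (1 - b) * _]mulrC -mulrA ler_wpM2l ?(ltW (Gamma_gt0 nb1))//.
apply: (@le_trans _ _ ((n.+1%:R + b) `^ (1 - b) * (n.+1%:R + b) `^ b)).
  rewrite ler_wpM2l ?powR_ge0//; apply: (ge0_ler_powR b0); rewrite ?nnegrE ?lerDl//.
  exact: ltW.
by rewrite -powRD subrK ?powRr1 ?(ltW nb0)// oner_eq0.
Qed.

Lemma scaled_negbinD1 b n : 0 <= b ->
  scaled_negbin (b + 1) n =
  scaled_negbin b n * ((1 + (b + 1) * harmonic n - harmonic n) / (b + 1)).
Proof.
move=> b0; rewrite /scaled_negbin /harmonic/=.
have n0 : 0 < n.+1%:R :> R by rewrite ltr0n.
have f0 : 0 < n`!%:R :> R by rewrite ltr0n fact_gt0.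
have b1 : 0 < b + 1 by rewrite ltr_wpDl.
have G0 : 0 < Gamma (1 + b) by rewrite Gamma_gt0// lerDl.
have E : negbin (1 + (b + 1)) n = negbin (1 + b) n * ((n.+1%:R + b) / (b + 1)).
  have b1' := ltW b1.
  have nE : n`!%:R * Gamma (1 + (b + 1)) != 0 :> R.
    apply: mulf_neq0; apply: lt0r_neq0; first exact: f0.
    by apply: Gamma_gt0; rewrite lerDl.
  apply: (mulfI nE); rewrite negbin_Gamma// addrA GammaD1; last first.
    by rewrite (@le_trans _ _ n.+1%:R) ?ler1n// lerDl.
  rewrite -negbin_Gamma// addrA GammaD1 ?lerDl//; field.
  by rewrite lt0r_neq0.
rewrite E opprD powRD ?(gt_eqF n0) ?implybT// powR_inv1 ?(ltW n0)//.
by field; rewrite !lt0r_neq0.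
Qed.

Lemma cvg_scaled_negbin01 b : 0 <= b <= 1 ->
  scaled_negbin b n @[n --> \oo] --> (Gamma (1 + b))^-1.
Proof.
move=> /[dup] b01 /andP[b0 b1].
have G0 : 0 < Gamma (1 + b) by rewrite Gamma_gt0// lerDl.
have hl : 1 - b * harmonic n @[n --> \oo] --> (1 : R).
  rewrite -[X in _ --> X]subr0; apply: cvgB; first exact: cvg_cst.
  by rewrite -[X in _ --> X](mulr0 b); apply: cvgMl_tmp; exact: cvg_harmonic.
have h : scaled_negbin b n * Gamma (1 + b) @[n --> \oo] --> (1 : R).
  apply: (squeeze_cvgr _ hl (cvg_cst (1 : R))); near=> n.
  have /andP[h1 ->] := scaled_negbin_bounds n b01; rewrite andbT.
  apply: le_trans h1; rewrite /harmonic/=.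
  set N := n.+1%:R; have N0 : 0 < N by rewrite ltr0n.
  have Nb0 : 0 < N + b by rewrite ltr_wpDr.
  rewrite ler_pdivlMr//; have -> : (1 - b / N) * (N + b) = N - b ^+ 2 / N.
    by field; rewrite lt0r_neq0.
  by rewrite gerBl divr_ge0// ?sqr_ge0// ltW.
rewrite -[X in _ --> X]mul1r.
under eq_cvg do rewrite -[scaled_negbin _ _](mulfK (lt0r_neq0 G0)).
exact: cvgMr_tmp.
Unshelve. all: by end_near. Qed.

(** Euler's limit formula for the Gamma function. *)
Lemma cvg_scaled_negbin b : 0 <= b ->
  scaled_negbin b n @[n --> \oo] --> (Gamma (1 + b))^-1.
Proof.
move=> b0.
have [k bk] : exists k : nat, b <= k%:R.
  by exists (Num.bound b); rewrite ltW// archi_boundP.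
elim: k b b0 bk => [|k IHk] b b0 bk.
  by apply: cvg_scaled_negbin01; rewrite b0 (le_trans bk).
have [b1|b1] := leP b 1; first by apply: cvg_scaled_negbin01; rewrite b0.
have h : 0 <= b - 1 by rewrite subr_ge0 ltW.
have -> : b = (b - 1) + 1 by rewrite subrK.
rewrite addrA GammaD1 ?lerDl// invfM mulrC.
under eq_cvg do rewrite scaled_negbinD1//.
apply: cvgM; first by apply: IHk => //; rewrite lerBlDr natr1.
rewrite [1 + (b - 1)]addrC -[X in _ --> X]mul1r; apply: cvgMr_tmp.
rewrite -[X in _ --> X]subr0; apply: cvgB; last exact: cvg_harmonic.
rewrite -[X in _ --> X]addr0; apply: cvgD; first exact: cvg_cst.
by rewrite -[X in _ --> X](mulr0 (b - 1 + 1)); apply: cvgMl_tmp; exact: cvg_harmonic.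
Qed.

(** For b >= 1 this is monotonicity in n, by Bernoulli's inequality; for
    b <= 1 both sides are within a factor 2 of the limit. *)
Lemma scaled_negbin_le b N n : 0 <= b -> (N <= n)%N ->
  scaled_negbin b n <= 2 * scaled_negbin b N.
Proof.
move=> b0 Nn; have [b1|b1] := leP b 1.
  have b01 : 0 <= b <= 1 by rewrite b0.
  have G0 : 0 < Gamma (1 + b) by rewrite Gamma_gt0// lerDl.
  rewrite -(ler_pM2r G0) -[2 * _ * _]mulrA.
  have /andP[_ h1] := scaled_negbin_bounds n b01.
  have /andP[h2 _] := scaled_negbin_bounds N b01.
  apply: (le_trans h1); apply: le_trans (ler_wpM2l (ler0n _ 2) h2).
  have Nb : 0 < N.+1%:R + b by rewrite ltr_wpDr// ltr0n.
  rewrite mulrA ler_pdivlMr// mul1r mulr_natl mulr2n lerD2l.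
  by rewrite (le_trans b1)// ler1n.
have bp : 0 < b by rewrite (lt_trans ltr01).
have mono k : scaled_negbin b k.+1 <= scaled_negbin b k.
  rewrite /scaled_negbin.
  have k0 : 0 < k.+1%:R :> R by rewrite ltr0n.
  have k1 : 0 < k.+2%:R :> R by rewrite ltr0n.
  have -> : negbin (1 + b) k.+1 = (k.+1%:R + b) / k.+1%:R * negbin (1 + b) k.
    apply: (mulfI (lt0r_neq0 k0)); rewrite negbinS -natr1; field.
    by rewrite natr1 lt0r_neq0.
  rewrite [_ / _ * _]mulrC -mulrA ler_wpM2l//; first by rewrite negbin_ge0// addr_ge0.
  rewrite !powRN ler_pdivrMr ?powR_gt0// [leRHS]mulrC.
  have s0 : 0 <= (k.+1%:R + b) / k.+1%:R by rewrite divr_ge0 ?addr_ge0.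
  have ib : 0 <= b^-1 <= 1 by rewrite invr_ge0 b0/= invf_le1// ltW.
  have h := powR_le_affine s0 ib.
  have h2 : ((k.+1%:R + b) / k.+1%:R) `^ b^-1 <= k.+2%:R / k.+1%:R.
    apply: (le_trans h); rewrite le_eqVlt; apply/orP; left; apply/eqP.
    rewrite -[k.+2%:R]natr1; field.
    by rewrite (lt0r_neq0 bp) /= ?andbT; have := lt0r_neq0 k0; rewrite -nat1r => ->.
  have := ge0_ler_powR b0 _ _ h2.
  rewrite -powRrM mulVf ?lt0r_neq0// powRr1// => /(_ _ _)/le_trans; apply.
  - by rewrite nnegrE powR_ge0.
  - by rewrite nnegrE divr_ge0.
  by rewrite powRM ?invr_ge0// -[_^-1]powR_inv1// -powRrM mulN1r powRN.
apply: (@le_trans _ _ (scaled_negbin b N)).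
  elim: n Nn => [|n IHn]; first by rewrite leqn0 => /eqP ->.
  rewrite leq_eqVlt => /predU1P[<-//|]; rewrite ltnS => /IHn.
  exact: le_trans (mono n).
by rewrite ler_peMl ?scaled_negbin_ge0// ler1n.
Qed.

Lemma relax_term_scaled a x n j :
  relax_term a (x * n.+1%:R `^ (- a)) n j = (- x) ^+ j * scaled_negbin (a * j%:R) n.
Proof.
rewrite /relax_term /scaled_negbin -mulNr exprMn -mulrA; congr (_ * _).
by rewrite mulrC; congr (_ * _); rewrite -powR_mulrn ?powR_ge0// -powRrM mulNr.
Qed.

(** Domination for Tannery's theorem: once N is so large that x (N + 1)^(-a) is
    small, the terms of all later discretizations are controlled by those of
    the N-th one. *)
Lemma scaled_relax_term_le a x N n j : 0 <= a <= 1 -> 0 <= x ->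
  x * N.+1%:R `^ (- a) <= expR (-1) / 2 -> (N <= n)%N ->
  `|(- x) ^+ j * scaled_negbin (a * j%:R) n| <= 2 * N.+1%:R ^+ N * 2^-1 ^+ j.
Proof.
move=> a01 x0 xN Nn; have [a0 a1] := andP a01.
have aj0 : 0 <= a * j%:R by rewrite mulr_ge0.
apply: (@le_trans _ _ (2 * `|(- x) ^+ j * scaled_negbin (a * j%:R) N|)).
  rewrite (normrM _ (scaled_negbin _ n)) (normrM _ (scaled_negbin _ N)).
  rewrite !(ger0_norm (scaled_negbin_ge0 _ aj0)) [leRHS]mulrCA ler_wpM2l//.
  exact: scaled_negbin_le.
rewrite -mulrA ler_wpM2l// -relax_term_scaled relax_term_le//.
by rewrite xN mulr_ge0 ?powR_ge0.
Qed.

Lemma near_powRN a (e : R) : 0 < a -> 0 < e -> \forall n \near \oo, n.+1%:R `^ (- a) <= e.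
Proof.
move=> a0 e0; near=> n.
have n0 : 0 < n.+1%:R :> R by rewrite ltr0n.
rewrite powRN -[leRHS]invrK lef_pV2 ?posrE ?powR_gt0 ?invr_gt0//.
have -> : e^-1 = (e^-1 `^ a^-1) `^ a by rewrite -powRrM mulVf ?gt_eqF// powRr1// invr_ge0 ltW.
apply: (ge0_ler_powR (ltW a0)); rewrite ?nnegrE ?powR_ge0//.
rewrite (@le_trans _ _ n%:R) ?ler_nat//.
by near: n; exact: nbhs_infty_ger.
Unshelve. all: by end_near. Qed.

Lemma near_scaled_small a x : 0 < a -> 0 <= x ->
  \forall n \near \oo, x * n.+1%:R `^ (- a) <= expR (-1) / 2.
Proof.
move=> a0 x0; have x1 : 0 < x + 1 by rewrite ltr_wpDl.
have e0 : 0 < expR (-1) / 2 / (x + 1) :> R by rewrite !divr_gt0 ?expR_gt0.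
near=> n; apply: (@le_trans _ _ (x * (expR (-1) / 2 / (x + 1)))).
  by rewrite ler_wpM2l//; near: n; exact: near_powRN.
by rewrite mulrA ler_pdivrMr// mulrC ler_wpM2l ?divr_ge0 ?expR_ge0 ?lerDl.
Unshelve. all: by end_near. Qed.

(** The discretization with step x^(1/a) / (n + 1) converges at x^(1/a); the
    index n instead of n + 1 does not change the limit. *)
Lemma cvg_relax_mittag_leffler a x : 0 < a <= 1 -> 0 <= x ->
  relax a (x * n.+1%:R `^ (- a)) n @[n --> \oo] --> mittag_leffler a (- x).
Proof.
move=> /andP[a0 a1] x0.
have [N _ /(_ N (leqnn N))/= HN] := near_scaled_small a0 x0.
rewrite /relax /mittag_leffler.
under eq_cvg do rewrite (funext (relax_term_scaled a x _)).
have [|j|] := @cvg_lim_series_half R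
    (fun n j => (- x) ^+ j * scaled_negbin (a * j%:R) n)
    (fun j => (- x) ^+ j / Gamma (j%:R * a + 1)) (2 * N.+1%:R ^+ N).
- near=> n => j; apply: scaled_relax_term_le => //; first by rewrite (ltW a0).
  by near: n; exact: nbhs_infty_ge.
- apply: cvgMl_tmp; rewrite addrC mulrC; apply: cvg_scaled_negbin.
  by rewrite mulr_ge0// ltW.
by [].
Unshelve. all: by end_near. Qed.

Lemma mittag_leffler_ge0 a x : 0 < a <= 1 -> 0 <= x -> 0 <= mittag_leffler a (- x).
Proof.
move=> a01 x0; have /andP[a0 a1] := a01.
have h := cvg_relax_mittag_leffler a01 x0.
rewrite -(cvg_lim _ h)//; apply: limr_ge; first by apply/cvg_ex; eexists; exact: h.
near=> n; apply: relax_ge0; first by rewrite (ltW a0).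
rewrite mulr_ge0 ?powR_ge0//=; near: n; exact: near_scaled_small.
Unshelve. all: by end_near. Qed.

Lemma mittag_leffler_anti a x y : 0 < a <= 1 -> 0 <= x -> x <= y ->
  mittag_leffler a (- y) <= mittag_leffler a (- x).
Proof.
move=> a01 x0 xy; have /andP[a0 a1] := a01; have y0 := le_trans x0 xy.
have hx := cvg_relax_mittag_leffler a01 x0.
have hy := cvg_relax_mittag_leffler a01 y0.
rewrite -(cvg_lim _ hx)// -(cvg_lim _ hy)//; apply: ler_lim.
- by apply/cvg_ex; eexists; exact: hy.
- by apply/cvg_ex; eexists; exact: hx.
near=> n; apply: relax_anti; first by rewrite (ltW a0).
- by rewrite mulr_ge0 ?powR_ge0.
- by rewrite ler_wpM2r ?powR_ge0.
by near: n; exact: near_scaled_small.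
Unshelve. all: by end_near. Qed.

(** Tannery's theorem applied to the Mittag-Leffler series itself, along
    x = 1 / (n + 1): only the constant term 1 survives in the limit. *)
Lemma mittag_leffler_near0 a c : 0 < a <= 1 -> c < 1 ->
  exists2 x, 0 < x & c < mittag_leffler a (- x).
Proof.
move=> a01 c1; have /andP[a0 a1] := a01.
have [N _ /(_ N (leqnn N))/= HN] := near_scaled_small a0 (@ler01 R).
pose u n j := (- harmonic n) ^+ j / Gamma (j%:R * a + 1) : R.
pose l j := (j == 0%N)%:R : R.
have ja j : 0 <= j%:R * a by rewrite mulr_ge0// ltW.
have h0 n : 0 <= harmonic n :> R by rewrite /harmonic/= invr_ge0.
have G0 j : 0 < Gamma (j%:R * a + 1) by rewrite Gamma_gt0// lerDr.
have [|j|_ h] := @cvg_lim_series_half R u l (2 * N.+1%:R ^+ N).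
- near=> n => j; rewrite /u normrM normrX normrN (ger0_norm (h0 n)).
  rewrite normfV (ger0_norm (ltW (G0 j))).
  apply: (@le_trans _ _ ((Gamma (j%:R * a + 1))^-1)).
    rewrite ler_piMl ?invr_ge0 ?(ltW (G0 j))// exprn_ile1// /harmonic/=.
    by rewrite invf_le1 ?ltr0n// ler1n.
  have hj : 0 <= a * j%:R by rewrite mulrC.
  have := cvg_scaled_negbin hj; rewrite addrC [a * _]mulrC => hl.
  rewrite -(cvg_lim _ hl)//; apply: limr_le; first by apply/cvg_ex; eexists; exact: hl.
  near=> m; have := @scaled_relax_term_le a 1 N m j _ ler01 HN.
  rewrite (ltW a0) a1 normrM normrX normrN normr1 expr1n mul1r => /(_ isT).
  rewrite mulrC ger0_norm ?scaled_negbin_ge0// [a * _]mulrC; apply.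
  by near: m; exact: nbhs_infty_ge.
- rewrite /u /l; case: j => [|j].
    under eq_cvg do rewrite expr0 mul0r add0r Gamma1 invr1 mulr1.
    exact: cvg_cst.
  rewrite -[X in _ --> X](mul0r (Gamma (j.+1%:R * a + 1))^-1); apply: cvgMr_tmp.
  apply: norm_cvg0; apply: (squeeze_cvgr _ (cvg_cst 0) (@cvg_harmonic R)); near=> n.
  rewrite normr_ge0 normrX normrN ger0_norm// exprS ler_piMr// exprn_ile1//.
  by rewrite /harmonic/= invf_le1 ?ltr0n// ler1n.
have l1 : limn (series l) = 1.
  apply: cvg_lim => //; rewrite -cvg_shiftS/=.
  rewrite (_ : (fun n => _) = (fun=> 1)); first exact: cvg_cst.
  apply/funext => n; rewrite /series/= big_nat_recl//= [X in _ + X]big1 ?addr0//.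
rewrite l1 in h.
have [n _ /(_ n (leqnn n))/= Hn] : \forall n \near \oo, c < limn (series (u n)).
  exact: (cvgr_gt _ h).
by exists (harmonic n) => //; rewrite /harmonic/= invr_gt0.
Unshelve. all: by end_near. Qed.

End MittagLeffler.

(** * Smooth functions *)

Section Smooth.
Set Implicit Arguments.
Unset Strict Implicit.
Unset Printing Implicit Defensive.
Context {R : realType}.
Implicit Types (f g u df : R -> R) (p q : {poly R}) (x y z a b c : R) (n : nat).
Local Notation mu := (@lebesgue_measure R).

Definition smooth f := forall n x, derivable (f^`(n)%classic) x 1.

(** Smoothness by coinduction: a class of derivable functions closed under
    derivation consists of smooth functions. *)
Lemma smooth_class (C : (R -> R) -> Prop) :
  (forall f, C f -> exists2 df, C df & forall x, is_derive x 1 f (df x)) ->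
  forall f, C f -> smooth f.
Proof.
move=> HC f Cf n.
have Cn : C (f^`(n)%classic).
  elim: n => [//|n /HC[df Cdf fdf]]; rewrite derive1nS.
  rewrite (_ : _^`()%classic = df)//; apply/funext => x.
  by rewrite derive1E; case: (fdf x).
by move=> x; have [df _ /(_ x)[]] := HC _ Cn.
Qed.

Lemma smooth_derive f : smooth f -> smooth (f^`()%classic).
Proof.
move=> sf; apply: (smooth_class (C := fun g => exists n, g = f^`(n)%classic)).
  move=> _ [n ->]; exists (f^`(n.+1)%classic); first by exists n.+1.
  by move=> x; apply: DeriveDef; [exact: sf|rewrite derive1nS derive1E].
by exists 1%N; rewrite derive1n1.
Qed.

Lemma smooth_is_derive f : smooth f -> forall x, is_derive x 1 f (f^`()%classic x).
Proof. by move=> sf x; apply: DeriveDef; [exact: (sf 0%N)|rewrite derive1E]. Qed.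

Lemma smooth_continuous f : smooth f -> continuous f.
Proof.
move=> sf x; apply/differentiable_continuous/derivable1_diffP.
exact: (sf 0%N).
Qed.

Lemma is_derive_derive1 f df : (forall x, is_derive x 1 f (df x)) -> f^`()%classic = df.
Proof. by move=> fdf; apply/funext => x; rewrite derive1E; case: (fdf x). Qed.

Lemma smooth_primitive f df : (forall x, is_derive x 1 f (df x)) -> smooth df -> smooth f.
Proof.
move=> fdf sdf [|n] x; first by case: (fdf x).
rewrite /derive1n iterSr -/(derive1n n _) (is_derive_derive1 fdf).
exact: sdf.
Qed.

(** The least class that contains the products of smooth functions and is
    closed under the Leibniz rule. *)
Inductive sum_of_smooth_products : (R -> R) -> Prop :=
| SmoothProduct f g : smooth f -> smooth g ->
    sum_of_smooth_products (fun x => f x * g x)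
| SmoothSum u v : sum_of_smooth_products u -> sum_of_smooth_products v ->
    sum_of_smooth_products (fun x => u x + v x).

Lemma smooth_sum_of_products u : sum_of_smooth_products u -> smooth u.
Proof.
apply: smooth_class => {}u.
elim=> [f g sf sg|{}u v _ [du cu hu] _ [dv cv hv]].
  exists (fun x => f x * g^`()%classic x + f^`()%classic x * g x).
    exact: (SmoothSum (SmoothProduct sf (smooth_derive sg))
      (SmoothProduct (smooth_derive sf) sg)).
  by move=> x; apply: is_deriveMf; exact: smooth_is_derive.
exists (fun x => du x + dv x); first exact: SmoothSum.
by move=> x; exact: is_deriveDf.
Qed.

Lemma smoothM f g : smooth f -> smooth g -> smooth (fun x => f x * g x).
Proof. by move=> sf sg; apply: smooth_sum_of_products; exact: SmoothProduct. Qed.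

Lemma smooth_cst c : smooth (fun=> c).
Proof.
apply: (smooth_class (C := fun g => exists c, g = fun=> c)); last by exists c.
by move=> _ [d ->]; exists (fun=> 0); [exists 0|move=> x; exact: is_derive_cst].
Qed.

Lemma smoothB f g : smooth f -> smooth g -> smooth (fun x => f x - g x).
Proof.
move=> sf sg.
apply: (smooth_class (C := fun u => exists2 f, smooth f & exists2 g, smooth g &
    u = fun x => f x - g x)); last by exists f => //; exists g.
move=> _ [h sh [k sk ->]].
exists (fun x => h^`()%classic x - k^`()%classic x).
  exists (h^`()%classic); first exact: smooth_derive.
  by exists (k^`()%classic); first exact: smooth_derive.
move=> x; apply: is_deriveDf; first exact: smooth_is_derive.
exact/is_deriveNf/smooth_is_derive.
Qed.

Lemma is_derive_affine f a b x (d : R) : is_derive (a * x + b) 1 f d ->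
  is_derive x 1 (fun t => f (a * t + b)) (a * d).
Proof.
move=> h; rewrite mulrC; apply: (@is_derive1_comp _ f (fun t => a * t + b)) => //.
rewrite -[X in is_derive _ _ _ X]addr0; apply: is_deriveDf.
by rewrite -[X in is_derive _ _ _ X]mulr1; apply: is_deriveZf; exact: is_derive_id.
Qed.

Lemma smooth_affine f a b : smooth f -> smooth (fun x => f (a * x + b)).
Proof.
move=> sf; apply: (smooth_class (C := fun u => exists2 g, smooth g &
    exists c, u = fun x => c * g (a * x + b))); last first.
  by exists f => //; exists 1; apply/funext => x; rewrite mul1r.
move=> _ [g sg [c ->]]; exists (fun x => c * (a * g^`()%classic (a * x + b))).
  exists (g^`()%classic); first exact: smooth_derive.
  by exists (c * a); apply/funext => x; rewrite mulrA.
by move=> x; apply: is_deriveZf; apply: is_derive_affine; exact: smooth_is_derive.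
Qed.

(** For p = 1 this is exp(- 1 / x) continued by 0; the polynomial factors make
    the class closed under derivation. *)
Definition flat p x : R := if 0 < x then p.[x^-1] * expR (- x^-1) else 0.

Lemma poly_le_exp p : exists2 C : R, 0 <= C & forall y : R, 0 <= y -> `|p.[y] * expR (- y)| <= C.
Proof.
exists (\sum_(i < size p) `|p`_i| * i`!%:R).
  by apply: sumr_ge0 => i _; rewrite mulr_ge0.
move=> y y0; rewrite horner_coef normrM (ger0_norm (expR_ge0 _)).
rewrite expRN ler_pdivrMr ?expR_gt0// mulr_suml.
apply: (le_trans (ler_norm_sum _ _ _)); apply: ler_sum => i _.
rewrite normrM -mulrA ler_wpM2l// ger0_norm ?exprn_ge0//.
case: (nat_of_ord i) => [|k]; first by rewrite expr0 fact0 mul1r -expR0 ler_expR.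
rewrite mulrC -ler_pdivrMr ?ltr0n ?fact_gt0//.
by apply: le_trans (expR_ge1Dxn k y0); rewrite lerDr.
Qed.

(** At 0, the difference quotient is bounded by a constant times |h|, since
    y^2 p(y) e^(-y) is bounded. *)
Lemma is_derive_flat p x : is_derive x 1 (flat p) (flat ('X^2 * (p - p^`())) x).
Proof.
have [x0|x0|->] := ltgtP x 0.
- rewrite {2}/flat ltNge (ltW x0)/=.
  apply: (@near_eq_is_derive _ _ _ (fun=> 0)).
  near=> t; rewrite /flat ltNge ltW//.
  by near: t; exact: lt_nbhsl.
- rewrite {2}/flat x0.
  have E : \near x, p.[x^-1] * expR (- x^-1) = flat p x.
    near=> t; rewrite /flat ifT//.
    by near: t; exact: lt_nbhsr.
  have dV : is_derive x 1 (fun t => t^-1) (- x ^- 2).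
    rewrite -[X in is_derive _ _ _ X]mulr1.
    exact: is_deriveV (lt0r_neq0 x0) (is_derive_id _ _).
  have dpV : is_derive x 1 (fun t => p.[t^-1]) (p^`().[x^-1] * - x ^- 2).
    exact: (@is_derive1_comp _ (horner p) (fun t => t^-1)).
  have dE : is_derive x 1 (fun t => expR (- t^-1)) (expR (- x^-1) * x ^- 2).
    rewrite -[x ^- 2]opprK.
    exact: (@is_derive1_comp _ expR (fun t => - t^-1) _ _ _ (is_derive_expR _) (is_deriveNf dV)).
  have := near_eq_is_derive E (is_deriveMf dpV dE); congr is_derive.
  by rewrite !hornerE exprVn /=; ring.
rewrite {2}/flat ltxx.
have [C C0 HC] := poly_le_exp ('X^2 * p).
have H : is_derive (0 : R) 1 (flat p) 0.
  have lim0 : (fun h => h^-1 *: (flat p (h *: 1 + 0) - flat p 0)) @ 0^' --> (0 : R).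
    apply: norm_cvg0.
    have hC : C * `|h| @[h --> (0 : R)^'] --> (0 : R).
      have hn : `|h| @[h --> (0 : R)^'] --> `|0 : R|.
        by apply: cvg_norm; apply: cvg_within_filter; exact: cvg_id.
      rewrite normr0 in hn; rewrite -[X in _ --> X](mulr0 C).
      exact: (cvgMl_tmp hn).
    apply: (squeeze_cvgr _ (cvg_cst (0 : R)) hC); near=> h.
    have hN0 : h != 0 by near: h; exact: nbhs_dnbhs_neq.
    rewrite normr_ge0/= /flat ltxx subr0 addr0 [h *: 1]mulr1.
    case: ifPn => [h0|_]; last by rewrite scaler0 normr0 mulr_ge0.
    rewrite normrZ normfV ler_pdivrMl ?normr_gt0// mulrCA -expr2.
    rewrite -ler_pdivrMr ?exprn_gt0 ?normr_gt0//.
    have y0 : 0 <= h^-1 by rewrite invr_ge0 ltW.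
    have := HC _ y0; apply: le_trans.
    by rewrite -normrX -normfV -normrM !hornerE -exprVn /= mulrC mulrA.
  by apply: DeriveDef; [exact: (cvgP _ lim0)|exact: (cvg_lim _ lim0)].
exact: H.
Unshelve. all: by end_near. Qed.

Lemma smooth_flat p : smooth (flat p).
Proof.
apply: (smooth_class (C := fun f => exists p, f = flat p)); last by exists p.
move=> _ [q ->]; exists (flat ('X^2 * (q - q^`()))); first by eexists.
exact: is_derive_flat.
Qed.

Definition bump x : R := flat 1 x * flat 1 (1 - x).

Lemma smooth_bump : smooth bump.
Proof.
apply: smoothM; first exact: smooth_flat.
have -> : (fun x => flat 1 (1 - x)) = (fun x => flat 1 (-1 * x + 1)).
  by apply/funext => x; rewrite mulN1r addrC.
exact/smooth_affine/smooth_flat.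
Qed.

Lemma bump_ge0 x : 0 <= bump x.
Proof.
by rewrite mulr_ge0// /flat; case: ifP => // _; rewrite hornerC mul1r expR_ge0.
Qed.

Lemma bump_gt0 x : 0 < x < 1 -> 0 < bump x.
Proof.
move=> /andP[x0 x1]; rewrite mulr_gt0// /flat ?subr_gt0 ?x0 ?x1 hornerC mul1r;
  exact: expR_gt0.
Qed.

Lemma bump_eq0 x : x <= 0 \/ 1 <= x -> bump x = 0.
Proof.
case=> h; rewrite /bump; last rewrite mulrC.
  by rewrite {1}/flat ltNge h mul0r.
by rewrite {1}/flat subr_gt0 ltNge h mul0r.
Qed.

Lemma continuous_integrable_itv f a b : continuous f ->
  mu.-integrable `[a, b] (EFin \o f).
Proof.
move=> cf; apply: continuous_compact_integrable; first exact: segment_compact.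
exact: continuous_subspaceT.
Qed.

(** Starting at -1 leaves room on the left of the support of the bump, so that
    the fundamental theorem also applies at 0. *)
Definition bump_primitive x : R := \int[mu]_(t in `[-1, x]) bump t.

Lemma is_derive_bump_primitive x : is_derive x 1 bump_primitive (bump x).
Proof.
have cb := smooth_continuous smooth_bump.
have [x1|x1] := ltP (-1) x.
  have xx : x < x + 1 by rewrite ltrDl.
  have [d1 d2] := continuous_FTC1_closed xx (continuous_integrable_itv (-1) (x + 1) cb) x1 (cb x).
  by apply: DeriveDef; [exact: d1|rewrite -derive1E; exact: d2].
have x0 : x <= 0 by lra.
rewrite bump_eq0; last by left.
apply: (@near_eq_is_derive _ _ _ (fun=> 0)).
near=> t; rewrite /bump_primitive; apply/esym.
rewrite (@eq_Rintegral _ _ _ mu _ (cst 0)) ?Rintegral_cst ?mul0r//.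
move=> y; rewrite inE/= in_itv/= => /andP[_ yt].
rewrite bump_eq0//; left; apply: (le_trans yt).
apply: ltW; near: t; apply: lt_nbhsl; lra.
Unshelve. all: by end_near. Qed.

Lemma derive_ge0_homo f (df : R -> R) : (forall x, is_derive x 1 f (df x)) ->
  (forall x, 0 <= df x) -> {homo f : x y / x <= y}.
Proof.
move=> fdf df0 x y; rewrite le_eqVlt => /predU1P[->//|xy].
have cf : {within `[x, y], continuous f}.
  apply: continuous_subspaceT => z.
  by apply/differentiable_continuous/derivable1_diffP; case: (fdf z).
have [z _ e] := MVT xy (fun z _ => fdf z) cf.
by rewrite -subr_ge0 e mulr_ge0// subr_ge0 ltW.
Qed.

Lemma derive_eq0_cst f (df : R -> R) x y : x <= y -> (forall z, is_derive z 1 f (df z)) ->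
  (forall z, x < z < y -> df z = 0) -> f x = f y.
Proof.
rewrite le_eqVlt => /predU1P[->//|xy] fdf df0.
have cf : {within `[x, y], continuous f}.
  apply: continuous_subspaceT => z.
  by apply/differentiable_continuous/derivable1_diffP; case: (fdf z).
have [z] := MVT xy (fun z _ => fdf z) cf.
by rewrite in_itv/= => /df0 -> /eqP; rewrite mul0r subr_eq0 => /eqP ->.
Qed.

Lemma smooth_step : exists theta rho : R -> R,
  [/\ smooth theta, smooth rho, forall x, is_derive x 1 theta (rho x),
      forall x, 0 <= rho x & [/\ forall x, x <= 0 \/ 1 <= x -> rho x = 0,
      forall x, x <= 0 -> theta x = 0 & forall x, 1 <= x -> theta x = 1]].
Proof.
pose c := bump_primitive 1.
have P0 x : x <= 0 -> bump_primitive x = 0.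
  move=> x0; rewrite /bump_primitive.
  rewrite (@eq_Rintegral _ _ _ mu _ (cst 0)) ?Rintegral_cst ?mul0r//.
  move=> y; rewrite inE/= in_itv/= => /andP[_ yt].
  by rewrite bump_eq0//; left; exact: le_trans x0.
have cP : continuous bump_primitive.
  move=> z; apply/differentiable_continuous/derivable1_diffP.
  by case: (is_derive_bump_primitive z).
have c0 : 0 < c.
  have [z] := MVT (@ltr01 R) (fun z _ => is_derive_bump_primitive z) (continuous_subspaceT cP).
  by rewrite in_itv/= => /bump_gt0 z0; rewrite (P0 0)// subr0 subr0 mulr1 /c => ->.
exists (fun x => c^-1 * bump_primitive x), (fun x => c^-1 * bump x).
have d x : is_derive x 1 (fun x => c^-1 * bump_primitive x) (c^-1 * bump x).
  exact/is_deriveZf/is_derive_bump_primitive.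
have sr : smooth (fun x => c^-1 * bump x).
  by apply: smoothM smooth_bump; exact: smooth_cst.
split; [exact: smooth_primitive sr|exact: sr|exact: d| |].
  by move=> x; rewrite mulr_ge0 ?bump_ge0// invr_ge0 ltW.
split=> x h; first by rewrite bump_eq0// mulr0.
  by rewrite P0// mulr0.
have E : c = bump_primitive x.
  apply: (derive_eq0_cst h is_derive_bump_primitive) => z /andP[z1 _].
  by rewrite bump_eq0//; right; exact: ltW.
by rewrite -E mulVf ?lt0r_neq0.
Qed.

End Smooth.

(** * Weak derivatives *)

Section WeakDerivative.
Set Implicit Arguments.
Unset Strict Implicit.
Unset Printing Implicit Defensive.
Context {R : realType}.
Implicit Types (f g u : R -> R) (x y z a b c e s t T : R) (n : nat).
Local Notation mu := (@lebesgue_measure R).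
Context (theta rho : R -> R)
  (smooth_theta : smooth theta) (smooth_rho : smooth rho)
  (theta_rho : forall x, is_derive x 1 theta (rho x))
  (rho_ge0 : forall x, 0 <= rho x)
  (rho_eq0 : forall x, x <= 0 \/ 1 <= x -> rho x = 0)
  (theta0 : forall x, x <= 0 -> theta x = 0)
  (theta1 : forall x, 1 <= x -> theta x = 1).

(* The smooth step rescaled to [s, s + e], and its derivative, an approximate
   identity at s as e tends to 0. The arguments are written as affine
   functions of x. *)
Let step s e x := theta (e^-1 * x + - (s / e)).
Let kern s e x := e^-1 * rho (e^-1 * x + - (s / e)).

Let is_derive_step s e x : is_derive x 1 (step s e) (kern s e x).
Proof. exact: is_derive_affine. Qed.

Let continuous_kern s e : continuous (kern s e).
Proof.
apply: smooth_continuous; apply: smoothM; first exact: smooth_cst.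
exact: smooth_affine.
Qed.

Let arg_sub s e x : 0 < e -> e^-1 * x + - (s / e) = (x - s) / e.
Proof. by move=> e0; field; exact: lt0r_neq0. Qed.

Let step0 s e x : 0 < e -> x <= s -> step s e x = 0.
Proof.
by move=> e0 xs; rewrite /step arg_sub// theta0// pmulr_lle0 ?invr_gt0// subr_le0.
Qed.

Let step1 s e x : 0 < e -> s + e <= x -> step s e x = 1.
Proof.
move=> e0 xs; rewrite /step arg_sub// theta1// ler_pdivlMr// mul1r.
by rewrite lerBrDr addrC.
Qed.

Let kern_eq0 s e x : 0 < e -> x <= s \/ s + e <= x -> kern s e x = 0.
Proof.
move=> e0 h; rewrite /kern arg_sub// rho_eq0 ?mulr0//.
case: h => h; [left|right]; first by rewrite pmulr_lle0 ?invr_gt0// subr_le0.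
by rewrite ler_pdivlMr// mul1r lerBrDr addrC.
Qed.

Let kern_ge0 s e x : 0 < e -> 0 <= kern s e x.
Proof. by move=> e0; rewrite mulr_ge0// invr_ge0 ltW. Qed.

Let step_bounds s e x : 0 <= step s e x <= 1.
Proof.
have mono := derive_ge0_homo theta_rho rho_ge0.
rewrite /step; set y := _ + _.
have [y0|y0] := leP y 0; first by rewrite theta0// lexx ler01.
have [y1|y1] := leP 1 y; first by rewrite theta1// lexx ler01.
by rewrite -(theta0 (lexx 0)) -(theta1 (lexx 1)) !mono// ltW.
Qed.

Let integral_kern s e : 0 < e -> \int[mu]_(x in `[s, s + e]) kern s e x = 1.
Proof.
move=> e0; have se : s < s + e by rewrite ltrDl.
have ckk : {within `[s, s + e], continuous (kern s e)}.
  exact: continuous_subspaceT.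
have cs : continuous (step s e).
  by move=> x; apply/differentiable_continuous/derivable1_diffP; case: (is_derive_step s e x).
rewrite /Rintegral (continuous_FTC2 se ckk (F := step s e)).
- by rewrite -EFinB/= step1// step0// subr0.
- split; first by move=> x _; case: (is_derive_step s e x).
  + by apply: cvg_at_right_filter; exact: cs.
  + by apply: cvg_at_left_filter; exact: cs.
- by move=> x _; rewrite derive1E; case: (is_derive_step s e x).
Qed.

Let integral_supp (D : set R) f s e : `[s, s + e] `<=` D ->
  (forall x, x <= s \/ s + e <= x -> f x = 0) ->
  \int[mu]_(x in D) f x = \int[mu]_(x in `[s, s + e]) f x.
Proof.
move=> sD f0; rewrite Rintegral_mkcond [RHS]Rintegral_mkcond.
congr (Rintegral _ _ _); apply/funext => x; rewrite !patchE.
case: ifPn => xD; case: ifPn => // xse; last first.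
  by move/set_mem: xse => /sD /mem_set; rewrite (negbTE xD).
rewrite f0//; move: xse; rewrite notin_setE/= in_itv/= => /negP.
rewrite negb_and -!ltNge => /orP[/ltW|/ltW]; by [left|right].
Qed.

(** The kernels concentrate at s from the right. *)
Let cvg_integral_kern u T s : 0 < s -> s < T -> {within `[0, T], continuous u} ->
  \int[mu]_(x in `]0, T[) (u x * kern s e x) @[e --> 0^'+] --> u s.
Proof.
move=> s0 sT cu; apply/cvgrPdist_le => eta eta0.
have cus : {for s, continuous u}.
  have T0 : 0 < T by rewrite (lt_trans s0).
  have /(continuous_within_itvP _ T0)[+ _ _] := cu.
  by apply; rewrite in_itv/= s0.
move/cvgrPdist_le : cus => /(_ _ eta0)[d /= d0 Hd].
have Hn : \forall e \near 0^'+, [/\ 0 < e, e < d & e < T - s].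
  near=> e; split; first by near: e; exact: nbhs_right_gt.
    by near: e; exact: nbhs_right_lt.
  by near: e; apply: nbhs_right_lt; rewrite subr_gt0.
apply: filterS Hn => e [e0 ed eT].
have He : forall x, `|x - s| <= e -> `|u s - u x| <= eta.
  by move=> x xe; apply: Hd => /=; rewrite distrC (le_lt_trans xe).
have seT : s + e < T by rewrite addrC -ltrBrDr.
have sub : `[s, s + e] `<=` `]0, T[.
  move=> x /=; rewrite !in_itv/= => /andP[sx xse].
  by rewrite (lt_le_trans s0)//= (le_lt_trans xse).
rewrite (integral_supp sub); last by move=> x h; rewrite kern_eq0// mulr0.
have cK : {within `[s, s + e], continuous (kern s e)} by exact: continuous_subspaceT.
have iK c : mu.-integrable `[s, s + e] (EFin \o (fun x => c * kern s e x)).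
  by apply: integrableZf => //; exact: continuous_integrable_itv.
have cuse : {within `[s, s + e], continuous u}.
  by apply: continuous_subspaceW cu => x /sub; exact: subset_itv_oo_cc.
have iuK : mu.-integrable `[s, s + e] (EFin \o (fun x => u x * kern s e x)).
  apply: continuous_compact_integrable; first exact: segment_compact.
  by move=> x; apply: cvgM; [exact: cuse|exact: cK].
have ineq x : `[s, s + e]%classic x ->
   (u s - eta) * kern s e x <= u x * kern s e x <= (u s + eta) * kern s e x.
  move=> /=; rewrite in_itv/= => /andP[sx xse].
  have := He x; rewrite ger0_norm ?subr_ge0// lerBlDl => /(_ xse).
  rewrite ler_norml => /andP[h1 h2].
  by rewrite !ler_wpM2r ?kern_ge0//; lra.
have H1 : \int[mu]_(x in `[s, s + e]) ((u s - eta) * kern s e x) <=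
    \int[mu]_(x in `[s, s + e]) (u x * kern s e x).
  by apply: le_Rintegral => // x /ineq/andP[].
have H2 : \int[mu]_(x in `[s, s + e]) (u x * kern s e x) <=
    \int[mu]_(x in `[s, s + e]) ((u s + eta) * kern s e x).
  by apply: le_Rintegral => // x /ineq/andP[].
have ik : mu.-integrable `[s, s + e] (EFin \o kern s e) by exact: continuous_integrable_itv.
rewrite RintegralZl// integral_kern// mulr1 in H1.
rewrite RintegralZl// integral_kern// mulr1 in H2.
by rewrite distrC ler_norml; apply/andP; split; lra.
Unshelve. all: by end_near. Qed.

Let step_diff s t e x := step s e x - step t e x.

Let smooth_step_diff s t e : smooth (step_diff s t e).
Proof. by apply: smoothB; exact: smooth_affine. Qed.

Let derive_step_diff s t e :
  (step_diff s t e)^`()%classic = (fun x => kern s e x - kern t e x).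
Proof.
apply: is_derive_derive1 => x.
by apply: is_deriveDf => //; exact: is_deriveNf.
Qed.

Let test_step_diff s t e T : 0 < e -> 0 < s -> s <= t -> t + e < T ->
  test_function T (step_diff s t e).
Proof.
move=> e0 s0 st teT.
have supp : closure [set x | step_diff s t e x != 0] `<=` `[s, t + e].
  have /closure_id -> : closed `[s, t + e]%classic by exact: interval_closed.
  apply: closure_subset => x /= h; rewrite in_itv/=; apply/andP; split.
    rewrite leNgt; apply: contraNN h => xs; rewrite /step_diff !step0 ?subrr//.
      exact: le_trans (ltW xs) st.
    exact: ltW.
  rewrite leNgt; apply: contraNN h => xs; rewrite /step_diff !step1 ?subrr//.
    exact: ltW.
  by rewrite (le_trans _ (ltW xs))// lerD2r.
split.
- exact: smooth_step_diff.
- by apply: subclosed_compact supp; [exact: closed_closure|exact: segment_compact].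
- apply: (subset_trans supp) => x /=; rewrite !in_itv/= => /andP[sx xt].
  by rewrite (lt_le_trans s0)//= (le_lt_trans xt).
Qed.

(** The differences of smooth steps tend to the indicator of ]s, t]. *)
Let cvg_integral_step g T s t : 0 < s -> s <= t -> t < T ->
  mu.-integrable `]0, T[ (EFin \o g) ->
  \int[mu]_(x in `]0, T[) (g x * step_diff s t (harmonic n) x) @[n --> \oo] -->
  \int[mu]_(x in `]s, t]) g x.
Proof.
move=> s0 st tT ig.
have h0 n : 0 < harmonic n :> R by rewrite /harmonic/= invr_gt0.
have mg : measurable_fun `]0, T[ g.
  by apply/measurable_EFinP; exact: measurable_int ig.
have mst : measurable_fun `]0, T[ (fun x => g x * \1_`]s, t] x).
  by apply: measurable_funM => //; apply: measurable_funTS; exact: measurable_indic.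
have mf n : measurable_fun `]0, T[ (fun x => g x * step_diff s t (harmonic n) x).
  apply: measurable_funM => //; apply: measurable_funTS.
  apply: continuous_measurable_fun; apply: smooth_continuous.
  exact: smooth_step_diff.
have cv x : (g x * step_diff s t (harmonic n) x)%:E @[n --> \oo] -->
    (g x * \1_`]s, t] x)%:E.
  apply: cvg_EFin; first exact: nearW.
  apply: cvgMl_tmp.
  have hsmall c : 0 < c -> \forall n \near \oo, harmonic n <= c :> R.
    move=> c0; have := @cvg_harmonic R => /cvgrPdist_le/(_ _ c0).
    by apply: filterS => n; rewrite sub0r normrN ger0_norm// ltW.
  apply: cvg_near_cst; rewrite /step_diff indicE.
  have [xs|xs] := leP x s.
    near=> n; rewrite !step0 ?subrr//; last exact: le_trans st.
    by rewrite memNset//= in_itv/= ltNge xs.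
  have [xt|xt] := leP x t.
    have xs0 : 0 < x - s by rewrite subr_gt0.
    have := hsmall _ xs0; apply: filterS => n hn.
    rewrite step1// ?step0 ?subr0// -?lerBrDl//.
    by rewrite mem_set//= in_itv/= xs.
  have xt0 : 0 < x - t by rewrite subr_gt0.
  have := hsmall _ xt0; apply: filterS => n hn.
  rewrite !step1 ?subrr -?lerBrDl//; last by rewrite (le_trans hn)// lerB.
  by rewrite memNset//= in_itv/= => /andP[_]; rewrite leNgt xt.
have bd x n : (`|(g x * step_diff s t (harmonic n) x)%:E| <= `|(g x)%:E|)%E.
  rewrite lee_fin normrM ler_piMr// /step_diff.
  have /andP[a0 a1] := step_bounds s (harmonic n) x.
  have /andP[b0 b1] := step_bounds t (harmonic n) x.
  by rewrite ler_norml; apply/andP; split; lra.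
have mD : measurable (`]0, T[%classic : set (measurableTypeR R)) by [].
have mfE n : measurable_fun `]0, T[ (fun x => (g x * step_diff s t (harmonic n) x)%:E).
  exact/measurable_EFinP.
have mstE : measurable_fun `]0, T[ (fun x => (g x * \1_`]s, t] x)%:E).
  exact/measurable_EFinP.
have [ist _ H] := dominated_convergence mD mfE mstE
  (aeW mu (fun x _ => cv x)) (integrable_abse ig) (aeW mu (fun x n _ => bd x n)).
have E : (\int[mu]_(x in `]0%R, T[) (g x * \1_`]s, t] x)%:E)%E = (\int[mu]_(x in `]s, t]) g x)%:E.
  transitivity (\int[mu]_(x in `]0, T[) (g x * \1_`]s, t] x))%:E.
    by rewrite /Rintegral fineK//; exact: integrable_fin_num.
  congr EFin.
  rewrite Rintegral_mkcond [RHS]Rintegral_mkcond; congr (Rintegral _ _ _).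
  apply/funext => x; rewrite !patchE indicE.
  case: ifPn => xT; case: ifPn => xst; rewrite ?mulr1 ?mulr0//.
  move: xT xst; rewrite notin_setE inE/= !in_itv/= => + /andP[sx xt].
  by rewrite (lt_trans s0 sx) (le_lt_trans xt tT).
rewrite E in H.
exact: (fine_cvg H).
Unshelve. all: by end_near. Qed.

(** The weak derivative tested on differences of smooth steps, in the limit. *)
Let weak_increment T u g s t : {within `[0, T], continuous u} ->
  mu.-integrable `]0, T[ (EFin \o g) -> is_weak_derivative T u g ->
  0 < s -> s <= t -> t < T -> \int[mu]_(x in `]s, t]) g x = u t - u s.
Proof.
move=> cu ig ug s0 st tT.
have t0 : 0 < t by rewrite (lt_le_trans s0).
have sT : s < T by rewrite (le_lt_trans st).
have h0 n : 0 < harmonic n :> R by rewrite /harmonic/= invr_gt0.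
have cvK z : 0 < z -> z < T ->
    \int[mu]_(x in `]0, T[) (u x * kern z (harmonic n) x) @[n --> \oo] --> u z.
  move=> z0 zT; have /cvg_at_rightP := cvg_integral_kern z0 zT cu; apply.
  by split; [exact: h0|exact: cvg_harmonic].
have iK z e : mu.-integrable `]0, T[ (EFin \o (fun x => u x * kern z e x)).
  have : mu.-integrable `[0, T] (EFin \o (fun x => u x * kern z e x)).
    apply: continuous_compact_integrable; first exact: segment_compact.
    have cK : {within `[0, T], continuous (kern z e)} by exact: continuous_subspaceT.
    by move=> x; apply: cvgM; [exact: cu|exact: cK].
  by apply: integrableS => //; exact: subset_itv_oo_cc.
pose A n := \int[mu]_(x in `]0, T[) (g x * step_diff s t (harmonic n) x).
pose B z n := \int[mu]_(x in `]0, T[) (u x * kern z (harmonic n) x).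
have H1 : B s n - B t n @[n --> \oo] --> u s - u t.
  by apply: cvgB; exact: cvK.
have H2 : - A n @[n --> \oo] --> - \int[mu]_(x in `]s, t]) g x.
  by apply: cvgN; exact: cvg_integral_step.
have H3 : \forall n \near \oo, B s n - B t n = - A n.
  have tT0 : 0 < T - t by rewrite subr_gt0.
  have := @cvg_harmonic R => /cvgrPdist_lt/(_ _ tT0); apply: filterS => n.
  rewrite sub0r normrN ger0_norm; last exact: ltW.
  rewrite ltrBrDl => tn.
  rewrite /A -(ug _ (test_step_diff (h0 n) s0 st tn)) derive_step_diff -RintegralB//.
  by apply: eq_Rintegral => x _; rewrite mulrBr.
have H4 : - A n @[n --> \oo] --> u s - u t.
  by apply: cvg_trans H1; exact: near_eq_cvg.
have := cvg_unique _ H2 H4 => /(_ (@Rhausdorff R)) e.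
by rewrite -[LHS]opprK e opprB.
Qed.

(** Both sides have the same increments in the open interval, and are
    continuous at its end points. *)
Lemma weak_FTC_aux T u g : 0 < T -> {within `[0, T], continuous u} ->
  mu.-integrable `]0, T[ (EFin \o g) -> is_weak_derivative T u g ->
  forall x, 0 <= x <= T -> \int[mu]_(t in `[0, x]) g t = u x - u 0.
Proof.
move=> T0 cu ig ug.
have igc := integrable_open_closed ig.
pose G x := \int[mu]_(t in `[0, x]) g t.
have cG : {within `[0, T], continuous G}.
  exact: parameterized_integral_continuous (ltW T0) igc.
have GB s t : 0 <= s -> s <= t -> t <= T -> G t - G s = \int[mu]_(x in `]s, t]) g x.
  move=> s0 st tT; rewrite /G Rintegral_itvB// ?bnd_simp//.
  by apply: integrableS igc => //; exact: subset_itvl.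
pose h x := u x - G x.
have ch : {within `[0, T], continuous h}.
  by move=> x; apply: cvgB; [exact: cu|exact: cG].
have /(continuous_within_itvP _ T0)[_ h0 hT] := ch.
pose c := h (T / 2).
have T2 : 0 < T / 2 < T by rewrite divr_gt0//= ltr_pdivrMr// ltr_pMr// ltr1n.
have /andP[T20 T2T] := T2.
have hc x : 0 < x < T -> h x = c.
  have aux s t : 0 < s -> s <= t -> t < T -> h s = h t.
    move=> s0 st tT; rewrite /h; have := GB _ _ (ltW s0) st (ltW tT).
    rewrite (weak_increment cu ig ug s0 st tT) => e; lra.
  move=> /andP[x0 xT]; rewrite /c; have [xt|xt] := leP x (T / 2); first exact: aux.
  by apply/esym; apply: aux => //; exact: ltW.
have h0c : h 0 = c.
  have hh : h x @[x --> 0^'+] --> c.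
    apply: cvg_near_cst; near=> x; apply: hc; apply/andP; split.
      by near: x; exact: nbhs_right_gt.
    by near: x; exact: nbhs_right_lt.
  exact: (cvg_unique (@Rhausdorff R) h0 hh).
have hTc : h T = c.
  have hh : h x @[x --> T^'-] --> c.
    apply: cvg_near_cst; near=> x; apply: hc; apply/andP; split.
      by near: x; exact: nbhs_left_gt.
    by near: x; exact: nbhs_left_lt.
  exact: (cvg_unique (@Rhausdorff R) hT hh).
have hx x : 0 <= x <= T -> h x = h 0.
  rewrite h0c => /andP[]; rewrite le_eqVlt => /predU1P[<- _//|x0].
  rewrite le_eqVlt => /predU1P[->//|xT]; apply: hc.
  by rewrite x0.
have G0 : G 0 = 0 by rewrite /G set_itv1 Rintegral_set1.
move=> x /hx; rewrite /h G0 subr0 -/(G x) => e; lra.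
Unshelve. all: by end_near. Qed.

End WeakDerivative.

Section WeakFTC.
Context {R : realType}.
Implicit Types (u g : R -> R) (T x : R).
Local Notation mu := (@lebesgue_measure R).

Lemma weak_FTC T u g : 0 < T -> {within `[0, T], continuous u} ->
  mu.-integrable `]0, T[ (EFin \o g) -> is_weak_derivative T u g ->
  forall x, 0 <= x <= T -> \int[mu]_(t in `[0, x]) g t = u x - u 0.
Proof.
have [theta [rho [st sr dt r0 [r1 t0 t1]]]] := @smooth_step R.
exact: (weak_FTC_aux st sr dt r0 r1 t0 t1).
Qed.

End WeakFTC.

(** * Integration by parts with a monotone weight *)

Section MonotoneWeight.
Set Implicit Arguments.
Unset Strict Implicit.
Unset Printing Implicit Defensive.
Context {R : realType}.
Implicit Types (phi p : R -> R) (x y s a t : R) (A : set R).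
Local Notation mu := (@lebesgue_measure R).

Lemma up_closed_itv A a t : A `<=` `[a, t] ->
  (forall x y, A x -> x <= y -> y <= t -> A y) ->
  A = set0 \/ exists2 s, a <= s <= t & A = `[s, t]%classic \/ A = `]s, t]%classic.
Proof.
move=> At Aup; have [->|/set0P[z Az]] := eqVneq A set0; [by left|right].
have lbA : has_inf A.
  by split; [exists z|exists a => x /At /=; rewrite in_itv/= => /andP[]].
have inf_lb x : A x -> inf A <= x by move=> Ax; apply: ge_inf => //; exact: lbA.2.
have /andP[az zt] : a <= z <= t by have := At _ Az; rewrite /= in_itv.
have ai : a <= inf A.
  by apply: lb_le_inf; [exists z|move=> x /At /=; rewrite in_itv/= => /andP[]].
exists (inf A); first by rewrite ai/= (le_trans (inf_lb _ Az)).
have [Ai|Ai] := pselect (A (inf A)); [left|right]; apply/seteqP; split=> x /=;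
  rewrite in_itv/=.
- by move=> Ax; rewrite inf_lb//=; have := At _ Ax; rewrite /= in_itv => /andP[].
- by move=> /andP[ix xt]; exact: Aup ix xt.
- move=> Ax; rewrite lt_neqAle inf_lb// andbT; apply/andP; split.
    by apply/eqP => e; apply: Ai; rewrite e.
  by have := At _ Ax; rewrite /= in_itv => /andP[].
- move=> /andP[ix xt]; have [y Ay yx] := inf_lt lbA.1 ix.
  exact: Aup Ay (ltW yx) xt.
Qed.

(** The integer part of y when 0 <= y <= M, written as a sum of indicators. *)
Fixpoint layers (M : nat) y : R :=
  if M is M'.+1 then layers M' y + (if M%:R <= y then 1 else 0) else 0.

Lemma layers_full M y : M%:R <= y -> layers M y = M%:R.
Proof.
elim: M => [//|M IHM] h /=; rewrite h IHM ?natr1//.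
by rewrite (le_trans _ h)// ler_nat.
Qed.

Lemma layers_bounds M y : 0 <= y <= M%:R -> y - 1 <= layers M y <= y.
Proof.
move=> /andP[y0]; elim: M => [|M IHM] yM /=.
  have -> : y = 0 by apply/eqP; rewrite eq_le y0 andbT.
  by rewrite lexx andbT gerBl.
have [h|h] := leP M.+1%:R y.
  have -> : y = M.+1%:R by apply/eqP; rewrite eq_le h yM.
  rewrite layers_full ?ler_nat// natr1 lexx andbT.
  by rewrite gerBl.
rewrite addr0; have [yM'|yM'] := leP y M%:R; first exact: IHM.
by rewrite layers_full ?(ltW yM')// andbT lerBlDr natr1.
Qed.

Lemma monotone_weight_integrable phi p a t : a <= t ->
  mu.-integrable `[a, t] (EFin \o p) ->
  (forall x y, a <= x -> x <= y -> y <= t -> 0 <= phi x <= phi y) ->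
  mu.-integrable `[a, t] (EFin \o (fun x => phi x * p x)).
Proof.
move=> at_ ip phi_mono.
have mphi : measurable_fun (`[a, t] : set R) phi.
  (* Monotonicity is known on [a, t] only, so phi is first made constant
     outside. *)
  pose clamp x := Num.min t (Num.max a x).
  have clampE x : a <= clamp x <= t.
    by rewrite le_min ge_min le_max !lexx at_ ?orbT.
  apply: (eq_measurable_fun (fun x => phi (clamp x))).
    move=> x; rewrite inE/= in_itv/= => /andP[ax xt].
    by rewrite /clamp max_r// min_r.
  apply: nondecreasing_measurable => // x y xy.
  have /andP[cx _] := clampE x; have /andP[_ cy] := clampE y.
  have cxy : clamp x <= clamp y by rewrite le_min2 ?le_max2.
  by have /andP[] := phi_mono _ _ cx cxy cy.
have bphi : [bounded phi x | x in (`[a, t] : set R)].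
  exists `|phi t|; split=> // M tM x /=; rewrite in_itv/= => /andP[ax xt].
  have /andP[p0 p1] := phi_mono x t ax xt (lexx t).
  by rewrite ger0_norm// (le_trans p1)// (le_trans (ler_norm _))// ltW.
have h : mu.-integrable `[a, t] ((EFin \o p) \* (EFin \o phi))%E by exact: integrableMl.
by apply: eq_integrable h => // x _; rewrite /= muleC.
Qed.

(** Integrating by layers: phi is a superposition of indicators of upper
    subintervals of [a, t], on which p has nonnegative integral. *)
Lemma monotone_weight_ge0 phi p a t : a <= t ->
  mu.-integrable `[a, t] (EFin \o p) ->
  (forall x y, a <= x -> x <= y -> y <= t -> 0 <= phi x <= phi y) ->
  (forall s, a <= s <= t -> 0 <= \int[mu]_(x in `[s, t]) p x) ->
  0 <= \int[mu]_(x in `[a, t]) (phi x * p x).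
Proof.
move=> at_ ip phi_mono tail.
have iphi := monotone_weight_integrable at_ ip phi_mono.
pose C := \int[mu]_(x in `[a, t]) `|p x|.
have iC : mu.-integrable `[a, t] (EFin \o (fun x => `|p x|)).
  by apply: eq_integrable (integrable_abse ip).
have main (N : nat) : - C <= N%:R * \int[mu]_(x in `[a, t]) (phi x * p x).
  have S (M : nat) : mu.-integrable `[a, t] (EFin \o (fun x => layers M (N%:R * phi x) * p x)) /\
     0 <= \int[mu]_(x in `[a, t]) (layers M (N%:R * phi x) * p x).
    elim: M => [|M [iM IHM]].
      have -> : (fun x => layers 0 (N%:R * phi x) * p x) = cst 0.
        by apply/funext => x /=; rewrite mul0r.
      by split; [exact: integrable0|rewrite Rintegral_ge0].
    pose A := [set x | `[a, t]%classic x /\ M.+1%:R <= N%:R * phi x].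
    have [mA [iA IA]] : [/\ measurable (A : set (measurableTypeR R)), 
        mu.-integrable `[a, t] (EFin \o (p \_ A)) & 0 <= \int[mu]_(x in `[a, t]) (p \_ A) x].
      have sA : A `<=` `[a, t] by move=> x [].
      have upA x y : A x -> x <= y -> y <= t -> A y.
        rewrite /A/= !in_itv/= => -[/andP[ax _] hx] xy yt.
        rewrite (le_trans ax xy) yt; split=> //; apply: (le_trans hx).
        by rewrite ler_wpM2l//; have /andP[] := phi_mono _ _ ax xy yt.
      have E : \int[mu]_(x in `[a, t]) (p \_ A) x = \int[mu]_(x in A) p x.
        rewrite Rintegral_mkcond [RHS]Rintegral_mkcond; congr (Rintegral _ _ _).
        apply/funext => x; rewrite !patchE; case: ifPn => // xat.
        by case: ifPn => // /set_mem/sA/mem_set; rewrite (negbTE xat).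
      have mA : measurable (A : set (measurableTypeR R)).
        by have [->|[s _ [->|->]]] := up_closed_itv sA upA.
      have iA : mu.-integrable A (EFin \o p) by apply: integrableS ip.
      split=> //.
        by rewrite -restrict_EFin; apply/integrable_restrict => //=; rewrite setIidr.
      rewrite E; have [->|[s ast hA]] := up_closed_itv sA upA.
        by rewrite Rintegral_set0.
      case: hA => hA; rewrite hA; first exact: tail.
      rewrite Rintegral_itv_obnd_cbnd; first exact: tail.
      by rewrite -hA.
    have LE x : `[a, t]%classic x -> layers M.+1 (N%:R * phi x) * p x =
        layers M (N%:R * phi x) * p x + (p \_ A) x.
      move=> xat; rewrite /= mulrDl patchE; congr (_ + _).
      case: ifPn => h; first by rewrite mem_set// mul1r.
      by rewrite memNset ?mul0r// => -[_]; rewrite (negbTE h).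
    split.
      apply: eq_integrable (integrableDf _ iM iA) => // x /set_mem xat.
      by rewrite /= -LE.
    rewrite (@eq_Rintegral _ _ _ mu _ (fun x => layers M (N%:R * phi x) * p x + (p \_ A) x)).
      by rewrite RintegralD// addr_ge0.
    by move=> x /set_mem; exact: LE.
  (* N phi differs by at most 1 from the number of its layers, hence the error
     C, the integral of the absolute value of p. *)
  pose M := Num.bound (N%:R * phi t).
  have [iM SM] := S M.
  rewrite -RintegralZl//.
  apply: (@le_trans _ _ (\int[mu]_(x in `[a, t]) (layers M (N%:R * phi x) * p x - `|p x|))).
    rewrite RintegralB//.
    by rewrite lerBrDr addNr.
  apply: le_Rintegral => //.
  - exact: integrableBf.
  - exact: integrableZf.
  move=> x /=; rewrite in_itv/= => /andP[ax xt].
  have /andP[p0 p1] := phi_mono x t ax xt (lexx t).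
  have h : 0 <= N%:R * phi x <= M%:R.
    rewrite mulr_ge0//= (@le_trans _ _ (N%:R * phi t))// ?ler_wpM2l//.
    by rewrite ltW// archi_boundP// mulr_ge0// (le_trans p0).
  have /andP[l1 l2] := layers_bounds h.
  rewrite mulrA lerBlDr -lerBlDl -mulrBl (le_trans (ler_norm _))// normrM ler_piMl//.
  by rewrite ler_norml lerBrDr [-1 + _]addrC l1/= lerBlDr (le_trans l2)// lerDr.
have C0 : 0 <= C by apply: Rintegral_ge0.
move: main; set I := \int[mu]_(x in `[a, t]) _ => main.
rewrite leNgt; apply/negP => I0.
have I0' : 0 < - I by rewrite oppr_gt0.
have := main (Num.bound (C / - I)).
rewrite lerNl -mulrN -ler_pdivlMr// leNgt => /negP; apply.
by apply: archi_boundP; rewrite divr_ge0// ltW.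
Qed.

(** The part of the integral over [0, a] is nonnegative, as u a - u s >= 0 for
    s <= a. On [a, t] the weight is split into the constant phi a, which gives
    the bound, and the increment phi - phi a, whose contribution is nonnegative
    as u t - u s >= 0. *)
Lemma monotone_weight_lower_bound phi p (u : R -> R) a t : 0 <= a -> a <= t ->
  mu.-integrable `[0, t] (EFin \o p) ->
  (forall x y, 0 <= x -> x <= y -> y <= t -> 0 <= phi x <= phi y) ->
  (forall x y, 0 <= x -> x <= y -> y <= t ->
     \int[mu]_(z in `[x, y]) p z = u y - u x) ->
  u a = 0 -> (forall s, 0 <= s <= a -> u s <= 0) ->
  (forall s, a <= s <= t -> u s <= u t) ->
  phi a * u t <= \int[mu]_(x in `[0, t]) (phi x * p x).
Proof.
move=> a0 at_ ip phi_mono pu ua ule umax.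
have iphi := monotone_weight_integrable (le_trans a0 at_) ip phi_mono.
have s1 : `[0, a] `<=` `[0, t].
  by move=> x /=; rewrite !in_itv/= => /andP[-> /le_trans ->].
have s2 : `[a, t] `<=` `[0, t].
  by move=> x /=; rewrite !in_itv/= => /andP[ax ->]; rewrite (le_trans a0).
have ip2 : mu.-integrable `[a, t] (EFin \o p) by apply: integrableS ip.
have iphi2 : mu.-integrable `[a, t] (EFin \o (fun x => phi x * p x)).
  by apply: integrableS iphi.
have h1 : 0 <= \int[mu]_(x in `[0, a]) (phi x * p x).
  apply: monotone_weight_ge0 => //.
  - by apply: integrableS ip.
  - by move=> x y x0 xy ya; apply: phi_mono => //; exact: le_trans at_.
  - move=> s /andP[s0 sa]; rewrite pu//.
    by rewrite ua sub0r oppr_ge0 ule// s0.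
have h2 : 0 <= \int[mu]_(x in `[a, t]) ((phi x - phi a) * p x).
  apply: monotone_weight_ge0 => //.
  - move=> x y ax xy yt; rewrite subr_ge0 lerD2r.
    have /andP[_ ->] := phi_mono a x a0 ax (le_trans xy yt).
    by have /andP[_ ->] := phi_mono x y (le_trans a0 ax) xy yt.
  - move=> s /andP[sa st]; rewrite pu//; last exact: le_trans a0 sa.
    by rewrite subr_ge0 umax// sa.
have e2 : \int[mu]_(x in `[a, t]) ((phi x - phi a) * p x) =
    \int[mu]_(x in `[a, t]) (phi x * p x) - phi a * u t.
  have -> : phi a * u t = \int[mu]_(x in `[a, t]) (phi a * p x).
    by rewrite RintegralZl// pu// ua subr0.
  rewrite -RintegralB//; last exact: integrableZf.
  by apply: eq_Rintegral => x _; rewrite mulrBl.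
have e1 : \int[mu]_(x in `[0, t]) (phi x * p x) =
    \int[mu]_(x in `[0, a]) (phi x * p x) + \int[mu]_(x in `[a, t]) (phi x * p x).
  rewrite -(@Rintegral_itv_obnd_cbnd _ a (BRight t)); last first.
    by apply: integrableS iphi2 => //; exact: subset_itv_oc_cc.
  rewrite -(Rintegral_itvB iphi) ?bnd_simp//.
  by rewrite addrC subrK.
by rewrite e1 -subr_ge0 -addrA -e2 addr_ge0.
Qed.

End MonotoneWeight.

(** * The comparison principle *)

Section Comparison.
Set Implicit Arguments.
Unset Strict Implicit.
Unset Printing Implicit Defensive.
Context {R : realType}.
Implicit Types (u v w g : R -> R) (a b s t T alpha : R) (B : R -> R).
Local Notation mu := (@lebesgue_measure R).

Lemma differentiable_on_continuous (A : set R) u :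
  differentiable_on A u -> {within A, continuous u}.
Proof.
move=> du; apply/subspace_continuousP => t At.
have /cvg_ex[l ul] := du t At.
apply/cvgrPdist_lt => e e0.
(* Away from t, this is u s. *)
have h : u t + (u s - u t) / (s - t) * (s - t) @[s --> within (A `\ t) (nbhs t)] --> u t.
  rewrite -[X in _ --> X]addr0 -(mulr0 l); apply: cvgD; first exact: cvg_cst.
  apply: cvgM => //; rewrite -(subrr t); apply: cvgB; last exact: cvg_cst.
  exact: cvg_within.
move/cvgrPdist_lt : h => /(_ _ e0); rewrite !near_withinE.
apply: filterS => s H As.
have [->|st] := eqVneq s t; first by rewrite subrr normr0.
have := H (conj As (elimN eqP st)).
by rewrite divfK ?subr_eq0// subrKC.
Qed.

Lemma within_continuous_eps (A : set R) u : {within A, continuous u} ->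
  forall t, A t -> forall e, 0 < e -> exists2 d, 0 < d &
    forall s, A s -> `|t - s| < d -> `|u t - u s| < e.
Proof.
move=> /subspace_continuousP cu t At e e0.
have /cvgrPdist_lt/(_ _ e0)[d /= d0 Hd] := cu t At.
by exists d => // s As ts; exact: Hd.
Qed.

(** On a bounded interval |u| <= 1 + u^2 is enough. *)
Lemma L2_integrable T u : L2_0T T u -> mu.-integrable `]0, T[ (EFin \o u).
Proof.
rewrite /L2_0T => u2.
have usq := Lfun2_integrable_sqr u2.
have mu_ : measurable_fun `]0, T[ u.
  move: u2; rewrite inE => /andP[]; rewrite inE/= => mu2 _.
  by apply/measurable_restrictT.
have i1 : mu.-integrable `]0, T[ (EFin \o cst (1 : R)).
  have : mu.-integrable `[0, T] (EFin \o cst (1 : R)).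
    exact/continuous_integrable_itv/cst_continuous.
  by apply: integrableS => //; exact: subset_itv_oo_cc.
have i2 : mu.-integrable `]0, T[ (EFin \o (fun x => (u \_ `]0, T[) x ^+ 2)).
  by apply: integrableS usq => //; exact: subsetT.
apply: (@le_integrable _ _ _ mu _ _ _ (EFin \o (fun x => 1 + (u \_ `]0, T[) x ^+ 2))) => //.
- exact/measurable_EFinP.
- move=> x xT /=; rewrite lee_fin patchE mem_set//.
  rewrite [X in _ <= X]ger0_norm ?addr_ge0 ?sqr_ge0//.
  have := sqr_ge0 (`|u x| - 1); rewrite sqrrB expr1n mulr1 real_normK ?num_real//.
  have := normr_ge0 (u x); lra.
- exact: integrableDf.
Qed.

Lemma weak_derivativeP T u : H1_0T T u ->
  L2_0T T (weak_derivative T u) /\ is_weak_derivative T u (weak_derivative T u).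
Proof.
move=> [_ [g g2 ug]].
by apply: (@xgetI _ (fun=> 0) [set g | L2_0T T g /\ is_weak_derivative T u g] g).
Qed.

Definition ABC_kernel alpha t s : R :=
  mittag_leffler alpha (- (alpha / (1 - alpha)) * (t - s) `^ alpha).

(** As s increases, the argument (t - s)^alpha decreases, and E_alpha(- x) is
    nonincreasing in x. *)
Lemma ABC_kernel_mono alpha t x y : 0 < alpha < 1 -> x <= y -> y <= t ->
  0 <= ABC_kernel alpha t x <= ABC_kernel alpha t y.
Proof.
move=> /andP[a0 a1] xy yt; rewrite /ABC_kernel !mulNr.
have a01 : 0 < alpha <= 1 by rewrite a0 ltW.
have l0 : 0 <= alpha / (1 - alpha) by rewrite divr_ge0 ?subr_ge0 ?ltW.
have l1 s : 0 <= alpha / (1 - alpha) * (t - s) `^ alpha.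
  exact: mulr_ge0 l0 (powR_ge0 _ _).
rewrite (mittag_leffler_ge0 a01 (l1 _))/=.
apply: (mittag_leffler_anti a01 (l1 _)).
rewrite ler_wpM2l//; apply: (ge0_ler_powR (ltW a0)); rewrite ?nnegrE ?subr_ge0//.
  exact: le_trans yt.
by rewrite lerD2l lerN2.
Qed.

Lemma ABC_kernel_near alpha c : 0 < alpha < 1 -> c < 1 ->
  exists2 d, 0 < d & forall s t, s <= t -> t - s <= d -> c < ABC_kernel alpha t s.
Proof.
move=> /andP[a0 a1] c1.
have a01 : 0 < alpha <= 1 by rewrite a0 ltW.
have [x0 x00 Hx] := mittag_leffler_near0 a01 c1.
have l0 : 0 < alpha / (1 - alpha) by rewrite divr_gt0 ?subr_gt0.
exists ((x0 / (alpha / (1 - alpha))) `^ alpha^-1); first by apply: powR_gt0; exact: divr_gt0 x00 l0.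
move=> s t st tsd; apply: (lt_le_trans Hx).
rewrite /ABC_kernel mulNr; apply: (mittag_leffler_anti a01 (mulr_ge0 (ltW l0) (powR_ge0 _ _))).
rewrite mulrC -ler_pdivlMr//.
have := ge0_ler_powR (ltW a0) _ _ tsd.
rewrite -powRrM mulVf ?gt_eqF// powRr1; last exact/ltW/divr_gt0.
apply.
  by rewrite nnegrE subr_ge0.
by rewrite nnegrE powR_ge0.
Qed.

Lemma weak_increments T u : 0 < T -> H1_0T T u -> {within `[0, T], continuous u} ->
  forall x y, 0 <= x -> x <= y -> y <= T ->
  \int[mu]_(z in `[x, y]) weak_derivative T u z = u y - u x.
Proof.
move=> T0 uH1 cu x y x0 xy yT.
have [g2 ug] := weak_derivativeP uH1.
have ig := L2_integrable g2; have igc := integrable_open_closed ig.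
have F := weak_FTC T0 cu ig ug.
have igy : mu.-integrable `[0, y] (EFin \o weak_derivative T u).
  apply: integrableS igc => // z /=; rewrite !in_itv/= => /andP[-> zy].
  exact: le_trans yT.
rewrite -(@Rintegral_itv_obnd_cbnd _ x (BRight y)); last first.
  apply: integrableS igy => // z /=; rewrite !in_itv/= => /andP[xz ->].
  by rewrite (le_trans x0)// ltW.
rewrite -(Rintegral_itvB igy) ?bnd_simp// !F; first by ring.
  by rewrite x0 (le_trans xy).
by rewrite (le_trans x0 xy).
Qed.

(** The point a is the supremum of the points up to which u is nonpositive:
    continuity forces u a = 0, and positive values accumulate at a from the
    right, since no b > a belongs to this set. *)
Lemma last_nonpositive T u : 0 < T -> {within `[0, T], continuous u} ->
  u 0 <= 0 -> (exists2 t, 0 <= t <= T & 0 < u t) ->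
  exists a, [/\ 0 <= a < T, u a = 0, forall s, 0 <= s <= a -> u s <= 0 &
    forall b, a < b <= T -> exists2 s, a < s <= b & 0 < u s].
Proof.
move=> T0 cu u0 [t0 /andP[t00 t0T] ut0].
pose S := [set x | 0 <= x <= T /\ forall s, 0 <= s <= x -> u s <= 0].
have S0 : S 0.
  split; first by rewrite lexx ltW.
  by move=> s; rewrite -eq_le => /eqP <-.
have hS : has_sup S by split; [exists 0|exists T => x [/andP[]]].
have supS x : S x -> x <= sup S by move=> Sx; apply: ub_le_sup => //; exact: hS.2.
pose a := sup S.
have a0 : 0 <= a by exact: supS.
have aT : a <= T by apply: ge_sup; [exists 0|move=> x [/andP[]]].
have aA : `[0, T]%classic a by rewrite /= in_itv/= a0.
have below s : 0 <= s -> s < a -> u s <= 0.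
  move=> s0 sa; have [y [_ Sy] sy] := sup_gt (ex_intro _ 0 S0) sa.
  by apply: Sy; rewrite s0 ltW.
have ua_le : u a <= 0.
  rewrite leNgt; apply/negP => ua0.
  have [d d0 Hd] := within_continuous_eps cu aA ua0.
  have [x [/andP[x0 xT] Sx] ax] := sup_adherent d0 hS.
  have xa : x <= a by apply: supS; split=> //; rewrite x0.
  have := Hd x; rewrite /= in_itv/= x0 xT ger0_norm ?subr_ge0// => /(_ isT).
  rewrite ltrBlDr -ltrBlDl => /(_ ax) h.
  have ux : u x <= 0 by apply: Sx; rewrite x0 lexx.
  by move: h; rewrite ger0_norm; lra.
have upto s : 0 <= s <= a -> u s <= 0.
  by move=> /andP[s0]; rewrite le_eqVlt => /predU1P[->//|]; exact: below.
have aT' : a < T.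
  rewrite lt_neqAle aT andbT; apply/eqP => e.
  by have := upto t0; rewrite e t00 t0T => /(_ isT); rewrite leNgt ut0.
have beyond b : a < b <= T -> exists2 s, a < s <= b & 0 < u s.
  move=> /andP[ab bT]; apply: contrapT => nex.
  have : S b.
    split; first by rewrite bT (le_trans a0)// ltW.
    move=> s /andP[s0 sb]; have [sa|sa] := leP s a; first by apply: upto; rewrite s0.
    by rewrite leNgt; apply/negP => us; apply: nex; exists s => //; rewrite sa.
  by move/supS; rewrite leNgt ab.
exists a; split=> //; first by rewrite a0.
apply/eqP; rewrite eq_le ua_le/= leNgt; apply/negP => ua0.
have Nua : 0 < - u a by rewrite oppr_gt0.
have [d d0 Hd] := within_continuous_eps cu aA Nua.
have bT : a < Num.min T (a + d / 2) <= T.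
  by rewrite lt_min aT' ltrDl divr_gt0//= ge_min lexx.
have [s /andP[sa]] := beyond _ bT.
rewrite le_min => /andP[sT sd] us.
have := Hd s; rewrite /= in_itv/= sT (le_trans a0 (ltW sa)) => /(_ isT).
rewrite ltr0_norm ?subr_lt0// opprB ltrBlDr.
have -> : s < d + a by lra.
by move=> /(_ isT); rewrite ltr0_norm ?subr_lt0 ?(lt_trans ua0)//; lra.
Qed.

Lemma ABC_derivative_sub B alpha T v w t : 0 < alpha < 1 -> 0 <= t <= T ->
  H1_0T T v -> H1_0T T w ->
  ABC_derivative B alpha T v t - ABC_derivative B alpha T w t =
  B alpha / (1 - alpha) * \int[mu]_(s in `[0, t])
    (ABC_kernel alpha t s * (weak_derivative T v s - weak_derivative T w s)).
Proof.
move=> a01 /andP[t0 tT] hv hw.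
have ig u : H1_0T T u -> mu.-integrable `[0, t]
    (EFin \o (fun s => ABC_kernel alpha t s * weak_derivative T u s)).
  move=> /weak_derivativeP[g2 _].
  apply: monotone_weight_integrable => //.
    apply: integrableS (integrable_open_closed (L2_integrable g2)) => // s /=.
    by rewrite !in_itv/= => /andP[-> /le_trans ->].
  by move=> x y _ xy yt; exact: ABC_kernel_mono.
rewrite /ABC_derivative -mulrBr -RintegralB//; [|exact: ig|exact: ig].
by congr (_ * _); apply: eq_Rintegral => s _; rewrite mulrBr.
Qed.

End Comparison.

Theorem theorem4p2 (R : realType) (alpha T : R) (B : R -> R)
  (f : R -> R -> R) (v w : R -> R) (L : R)
  (alpha_gt0 : 0 < alpha) (alpha_lt1 : alpha < 1) (T_gt0 : 0 < T)
  (B_alpha : 0 < B alpha) (B_0 : B 0 = 1) (B_1 : B 1 = 1)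
  (f_cont : {within `[0, T] `*` [set: R],
               continuous (fun p : R * R => f p.1 p.2)})
  (v_diff : differentiable_on `[0, T] v)
  (w_diff : differentiable_on `[0, T] w)
  (v_dom : H1_0T T v) (w_dom : H1_0T T w)
  (Dv_cont : {within `[0, T], continuous (ABC_derivative B alpha T v)})
  (Dw_cont : {within `[0, T], continuous (ABC_derivative B alpha T w)})
  (v_lower : forall tau, tau \in `[0, T] ->
     ABC_derivative B alpha T v tau <= f tau (v tau))
  (w_upper : forall tau, tau \in `[0, T] ->
     f tau (w tau) <= ABC_derivative B alpha T w tau)
  (L_gt0 : 0 < L) (L_lt : L < B alpha / (1 - alpha))
  (f_lip : forall tau, tau \in `[0, T] -> forall omega eta : R,
     eta <= omega -> f tau omega - f tau eta <= L * (omega - eta)) :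
  v 0 <= w 0 -> forall tau, tau \in `[0, T] -> v tau <= w tau.
Proof.
move=> vw0 tau tauT.
have k0 : 0 < B alpha / (1 - alpha) by rewrite divr_gt0 ?subr_gt0.
have a01 : 0 < alpha < 1 by rewrite alpha_gt0.
have cv := differentiable_on_continuous v_diff.
have cw := differentiable_on_continuous w_diff.
pose m t := v t - w t.
have cm : {within `[0, T], continuous m}.
  by move=> t; apply: cvgB; [exact: cv|exact: cw].
rewrite leNgt; apply/negP => wv.
have m0 : m 0 <= 0 by rewrite subr_le0.
have mpos : exists2 t, 0 <= t <= T & 0 < m t.
  by exists tau; [move: tauT; rewrite ?inE/= ?in_itv|rewrite subr_gt0].
have [a [/andP[a0 aT] ma ma_le beyond]] := last_nonpositive T_gt0 cm m0 mpos.
have c1 : L / (B alpha / (1 - alpha)) < 1 by rewrite ltr_pdivrMr// mul1r.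
have [d d0 Kd] := ABC_kernel_near a01 c1.
(* So short an interval that the value at a of the kernel of any later point c
   in it still exceeds L (1 - alpha) / B(alpha). *)
pose b := Num.min T (a + d).
have ab : a < b by rewrite lt_min aT ltrDl.
have bT : b <= T by rewrite ge_min lexx.
have cmb : {within `[a, b], continuous m}.
  apply: continuous_subspaceW cm => x /=; rewrite !in_itv/= => /andP[ax xb].
  by rewrite (le_trans a0 ax) (le_trans xb bT).
have [c cab mmax] := EVT_max (ltW ab) cmb.
have /andP[ac cb] : a <= c <= b by move: cab; rewrite in_itv.
have mc : 0 < m c.
  have [|s /andP[sa sb] ms] := beyond b; first by rewrite ab.
  have sab : s \in `[a, b]%R by rewrite in_itv/= (ltW sa).
  exact: lt_le_trans ms (mmax _ sab).
have cT : c <= T := le_trans cb bT.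
have c0 : 0 <= c := le_trans a0 ac.
have c0T : 0 <= c <= T by rewrite c0.
pose g s := weak_derivative T v s - weak_derivative T w s.
have sub x y : 0 <= x -> y <= T -> `[x, y] `<=` `[0, T].
  by move=> x0 yT z /=; rewrite !in_itv/= => /andP[xz zy]; rewrite (le_trans x0 xz) (le_trans zy yT).
have ig u x y : H1_0T T u -> 0 <= x -> y <= T ->
    lebesgue_measure.-integrable `[x, y] (EFin \o weak_derivative T u).
  move=> /weak_derivativeP[u2 _] x0 yT.
  apply: integrableS (integrable_open_closed (L2_integrable u2)) => //.
  exact: sub.
have low : ABC_kernel alpha c a * m c <=
    \int[lebesgue_measure]_(s in `[0, c]) (ABC_kernel alpha c s * g s).
  apply: monotone_weight_lower_bound => //.
  - by apply: integrableBf => //; exact: ig.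
  - by move=> x y _ xy yc; exact: ABC_kernel_mono.
  - move=> x y x0 xy yc; have yT := le_trans yc cT.
    rewrite RintegralB//; [|exact: ig|exact: ig].
    by rewrite !weak_increments// /m; ring.
  - move=> s /andP[sa sc]; apply: mmax.
    by rewrite in_itv/= sa (le_trans sc).
have diff : ABC_derivative B alpha T v c - ABC_derivative B alpha T w c <= L * m c.
  have cin : c \in `[0, T] by rewrite ?inE/= ?in_itv/=.
  have h1 := v_lower c cin; have h2 := w_upper c cin.
  have wvc : w c <= v c by rewrite -subr_ge0 ltW.
  have h3 := f_lip c cin _ _ wvc.
  rewrite lerBlDr (le_trans h1)// (le_trans _ (lerD (lexx _) h2))//.
  by rewrite -lerBlDr.
rewrite (ABC_derivative_sub _ a01 c0T v_dom w_dom) in diff.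
have : L / (B alpha / (1 - alpha)) < ABC_kernel alpha c a.
  by apply: Kd => //; rewrite lerBlDl (le_trans cb)// ge_min lexx orbT.
rewrite ltNge => /negP; apply; rewrite ler_pdivlMr// -(ler_pM2r mc).
apply: le_trans diff; rewrite mulrAC mulrC ler_pM2l//.
Qed.
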